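(* Consider a class of functions $(\gamma,\lambda,\mu)$ with $\gamma,\lambda:\bar\Omega\times[0,T]\to\mathbb{R}^3$ and $\mu:\bar\Omega\times[0,T]\to\mathbb{R}^{3\times3}$, such that the difference $(\Delta\gamma,\Delta\lambda,\Delta\mu)$ of any two functions in the class satisfies $$\begin{aligned} &\partial_t\Delta\gamma+\operatorname{div}\Delta\mu=0 &&\text{on }\partial\Omega_u\times(0,T),\\ &\big(C A^{-1}(\Delta\mu^{(s)}-C^T\nabla\Delta\lambda)\big)n=0 &&\text{on }\partial\Omega_s\times(0,T),\\ &\partial_t\Delta\gamma+\operatorname{div}\Delta\mu=0 &&\text{on }\Omega\times\{0\},\\ &\tfrac1{\mathsf{r}}(\Delta\gamma+\rho\,\partial_t\Delta\lambda)=0 &&\text{on }\Omega\times\{0\},\\ &\Delta\gamma=0,\quad \Delta\lambda=0 &&\text{on }\Omega\times\{T\},\\ &\Delta\lambda=0 &&\text{on }\partial\Omega_u\times(0,T),\\ &\Delta\mu\,n=0 &&\text{on }\partial\Omega_s\times(0,T),\\ &\Delta\mu^{(a)}n=0 &&\text{on }\partial\Omega_s\times(0,T),\\ &(C^T\nabla\Delta\lambda-\Delta\mu^{(s)})\,n=0 &&\text{on }\partial\Omega_s\times(0,T),\\ &\Delta\gamma+\rho\,\partial_t\Delta\lambda=0 &&\text{on }\Omega\times\{T\}. \end{aligned}$$ Furthermore, assume that $\Delta\mu$ is continuous on $\bar\Omega\times[0,T]$. If $\rho>0$ and $C$ is positive-definite with major symmetry, then there is at most one solution in this class of functions to the system $$\begin{aligned}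 &\partial_t\big(\bar u-(\partial_t\gamma+\operatorname{div}\mu)\big)-\big(\bar v-\tfrac1{\mathsf{r}}(\gamma+\rho\,\partial_t\lambda)\big)=0 &&\text{on }\Omega\times(0,T),\\ &\rho\,\partial_t\big(\bar v-\tfrac1{\mathsf{r}}(\gamma+\rho\,\partial_t\lambda)\big)-\operatorname{div}\Big(C\big(\bar E-A^{-1}(\mu^{(s)}-C^T\nabla\lambda)\big)\Big)-b=0 &&\text{on }\Omega\times(0,T),\\ &\nabla\big(\bar u-(\partial_t\gamma+\operatorname{div}\mu)\big)-\big(\bar E-A^{-1}(\mu^{(s)}-C^T\nabla\lambda)\big)-(\bar W-\mu^{(a)})=0 &&\text{on }\Omega\times(0,T),\\ &\bar u-(\partial_t\gamma+\operatorname{div}\mu)=u^{(b)} &&\text{on }\partial\Omega_u\times(0,T),\\ &\Big(C\big(\bar E-A^{-1}(\mu^{(s)}-C^T\nabla\lambda)\big)\Big)n=t &&\text{on }\partial\Omega_s\times(0,T),\\ &\bar u-(\partial_t\gamma+\operatorname{div}\mu)=u^{(0)} &&\text{on }\Omega\times\{0\},\\ &\bar v-\tfrac1{\mathsf{r}}(\gamma+\rho\,\partial_t\lambda)=v^{(0)} &&\text{on }\Omega\times\{0\},\\ &\gamma=0,\quad\lambda=0 &&\text{on }\Omega\times\{T\},\\ &\lambda=0 &&\text{on }\partial\Omega_u\times(0,T),\\ &\mu n=0 &&\text{on }\partial\Omega_s\times(0,T), \end{aligned}$$ where the right-hand sides of the last four conditions (on $\gamma(\cdot,T)$, $\lambda(\cdot,T)$,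 $\lambda$ on $\partial\Omega_u$, $\mu n$ on $\partial\Omega_s$) may also be replaced by arbitrarily assigned fixed functions.
   Context: $\Omega\subset\mathbb{R}^3$ is a domain with boundary $\partial\Omega=\overline{\partial\Omega_s\cup\partial\Omega_u}$, $\partial\Omega_s,\partial\Omega_u$ disjoint, $n$ is the outward unit normal, $T>0$. The elastic moduli $C=C(x)$ form a fourth-order tensor field with minor symmetries $C_{ijkl}=C_{jikl}=C_{ijlk}$; $(C^T)_{ijkl}:=C_{klij}$; major symmetry means $C=C^T$; positive-definite means $e:Ce>0$ for every nonzero symmetric second-order tensor $e$. $\rho=\rho(x)$ is a scalar density field. $A=A(x,t)$ is a given fourth-order tensor field with major symmetry, positive-definite on the space of symmetric second-order tensors, and $A^{-1}$ is its inverse on that space; $\mathsf{r}=\mathsf{r}(x)>0$ is a given scalar field. The fields $\bar u,\bar v$ (vector-valued), $\bar E$ (symmetric tensor-valued), $\bar W$ (antisymmetric tensor-valued) are arbitrarily given functions on space-time, and $b,u^{(b)},t,u^{(0)},v^{(0)}$ are given data. Notation: $(\nabla\lambda)_{ij}=\partial_j\lambda_i$, $(C^T\nabla\lambda)_{mn}=C_{ijmn}\partial_j\lambda_i$, $(Ce)_{ij}=C_{ijkl}e_{kl}$, $(\operatorname{div}\mu)_i=\partial_j\mu_{ij}$; $\mu^{(s)}$ and $\mu^{(a)}$ are the symmetric and antisymmetric parts of $\mu$ (and $\Delta\mu^{(s)},\Delta\mu^{(a)}$ those of $\Delta\mu$); '':'' is the inner product of second-order tensors. Regularity is formal: $\Omega$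 is bounded with boundary regular enough for the divergence theorem, and all data and functions in the class are sufficiently smooth up to the boundary that the derivatives above exist and integration by parts in space and time is permitted (for definiteness, one may take all data and functions to be $C^2$ on the closures). *)

(* Defs.v *)
From HB Require Import structures.
From mathcomp Require Import all_boot all_order all_algebra.
From mathcomp Require Import all_classical all_reals all_analysis.

Set Implicit Arguments.
Unset Strict Implicit.
Unset Printing Implicit Defensive.

Import Order.TTheory GRing.Theory Num.Theory.
Import numFieldNormedType.Exports.

Local Open Scope classical_set_scope.
Local Open Scope ring_scope.

Notation vec R := ('rV[R]_3).
Notation tensor2 R := ('M[R]_3).
Notation tensor4 R := ('I_3 -> 'I_3 -> 'I_3 -> 'I_3 -> R).
Notation stime R := ('rV[R]_3 * R)%type.

Definition C1_on (R : realType) (W X : normedModType R) (U : set W)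
    (f : W -> X) : Prop :=
  (forall p, U p -> differentiable f p) /\
  (forall w p, U p -> {for p, continuous ('D_w f)}).

Definition C2_on (R : realType) (W X : normedModType R) (U : set W)
    (f : W -> X) : Prop :=
  C1_on U f /\ forall w, C1_on U ('D_w f).

(* Smoothness "up to the boundary" of a closed set K: the function is smooth on
   an open neighbourhood of K.  When K is the closure of an open set, the
   derivatives at the points of K are the limits of the derivatives in the
   interior, so they do not depend on the values of f outside of K. *)
Definition C1_near (R : realType) (W X : normedModType R) (K : set W)
    (f : W -> X) : Prop :=
  exists U : set W, [/\ open U, K `<=` U & C1_on U f].

Definition C2_near (R : realType) (W X : normedModType R) (K : set W)
    (f : W -> X) : Prop :=
  exists U : set W, [/\ open U, K `<=` U & C2_on U f].

Definition C2_near_tensor4 (R : realType) (W : normedModType R) (K : set W)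
    (f : W -> tensor4 R) : Prop :=
  forall i j k l, C2_near K (fun p => f p i j k l : R).

Definition dotv (R : realType) (a b : vec R) : R := \sum_j a 0 j * b 0 j.

Definition tapp (R : realType) (M : tensor2 R) (n : vec R) : vec R :=
  \row_i \sum_j M i j * n 0 j.

Definition ddot (R : realType) (a b : tensor2 R) : R :=
  \sum_i \sum_j a i j * b i j.

Definition symt (R : realType) (e : tensor2 R) : Prop := e^T = e.
Definition antisymt (R : realType) (e : tensor2 R) : Prop := e^T = - e.

Definition sympart (R : realType) (e : tensor2 R) : tensor2 R :=
  2^-1 *: (e + e^T).
Definition skewpart (R : realType) (e : tensor2 R) : tensor2 R :=
  2^-1 *: (e - e^T).

Definition app4 (R : realType) (C : tensor4 R) (e : tensor2 R) : tensor2 R :=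
  \matrix_(i, j) \sum_k \sum_l C i j k l * e k l.

Definition tr4 (R : realType) (C : tensor4 R) : tensor4 R :=
  fun i j k l => C k l i j.

Definition minor_sym (R : realType) (C : tensor4 R) : Prop :=
  forall i j k l, C i j k l = C j i k l /\ C i j k l = C i j l k.

Definition major_sym (R : realType) (C : tensor4 R) : Prop := C = tr4 C.

Definition posdef_sym (R : realType) (C : tensor4 R) : Prop :=
  forall e : tensor2 R, symt e -> e != 0 -> 0 < ddot e (app4 C e).

Definition inverse_sym (R : realType) (A B : tensor4 R) : Prop :=
  forall e : tensor2 R, symt e ->
    [/\ symt (app4 B e), app4 A (app4 B e) = e & app4 B (app4 A e) = e].

Definition dirx (R : realType) (j : 'I_3) : stime R := (delta_mx 0 j, 0).
Definition dirt (R : realType) : stime R := (0, 1).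

Definition dt (R : realType) (X : normedModType R) (f : stime R -> X)
    (p : stime R) : X := 'D_(dirt R) f p.

Definition grad (R : realType) (f : stime R -> vec R) (p : stime R)
  : tensor2 R := \matrix_(i, j) ('D_(dirx R j) f p) 0 i.

Definition divT (R : realType) (M : stime R -> tensor2 R) (p : stime R)
  : vec R := \row_i \sum_j ('D_(dirx R j) M p) i j.

Definition sgrad (R : realType) (f : vec R -> R) (x : vec R) : vec R :=
  \row_j 'D_(delta_mx 0 j : vec R) f x.

Definition sdiv (R : realType) (F : vec R -> vec R) (x : vec R) : R :=
  \sum_j ('D_(delta_mx 0 j : vec R) F x) 0 j.

Definition boundary (R : realType) (Omega : set (vec R)) : set (vec R) :=
  closure Omega `&` closure (~` Omega).

(* Near the boundary point x the boundary is a C^1 surface {phi = 0} with Omega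
   on its side {phi < 0}, and nu is the unit vector in the direction of the
   gradient of phi at x. *)
Definition outward_unit_normal (R : realType) (Omega : set (vec R))
    (x nu : vec R) : Prop :=
  [/\ boundary Omega x, dotv nu nu = 1 &
   exists (phi : vec R -> R) (U : set (vec R)),
     [/\ open U, U x, C1_on U phi,
         forall y, U y -> (Omega y <-> phi y < 0) &
         exists2 c : R, 0 < c & sgrad phi x = c *: nu]].

(* the part of the boundary on which the normal exists, i.e. the boundary
   without its edges and corners *)
Definition regular_boundary (R : realType) (Omega : set (vec R))
  : set (vec R) := [set x | exists nu, outward_unit_normal Omega x nu].

Definition is_normal_field (R : realType) (Omega : set (vec R))
    (n : vec R -> vec R) : Prop :=
  forall x, regular_boundary Omega x -> outward_unit_normal Omega x (n x).

(* Lebesgue measure is available on R * R * R, with its product (Borel)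
   sigma-algebra; pt transports it to row vectors. *)
Notation meas3 R :=
  (measurableTypeR R * measurableTypeR R * measurableTypeR R)%type.

Definition pt (R : realType) (p : R * R * R) : vec R :=
  \row_(i < 3) [:: p.1.1; p.1.2; p.2]`_i.

Definition volume (R : realType) : set (meas3 R) -> \bar R :=
  ((@lebesgue_measure R \x @lebesgue_measure R) \x @lebesgue_measure R)%E.

(* The divergence theorem holds on Omega.  The finite measure sigma is the
   surface measure: as n is a unit vector on the regular boundary, which carries
   sigma, the identity determines sigma.  No measure is given to the edges and
   corners. *)
Definition divergence_theorem (R : realType) (Omega : set (vec R))
    (n : vec R -> vec R) : Prop :=
  exists sigma : {finite_measure set (meas3 R) -> \bar R},
    sigma.-negligible (@pt R @^-1` ~` regular_boundary Omega) /\
    forall F : vec R -> vec R, C1_near (closure Omega) F ->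
      (\int[@volume R]_(p in @pt R @^-1` Omega) (sdiv F (pt p))%:E =
       \int[sigma]_(p in @pt R @^-1` regular_boundary Omega)
          (dotv (F (pt p)) (n (pt p)))%:E)%E.

Definition regular_domain (R : realType) (Omega : set (vec R))
    (n : vec R -> vec R) : Prop :=
  [/\ open Omega, connected Omega, Omega !=set0, bounded_set Omega &
      is_normal_field Omega n /\ divergence_theorem Omega n].

Definition ccyl (R : realType) (Omega : set (vec R)) (T : R)
  : set (stime R) := [set p | closure Omega p.1 /\ 0 <= p.2 <= T].

(* Ainv is the field A^{-1}; it is tied to Am in admissible_coefficients. *)
Record coefficients (R : realType) := Coefficients {
  Cm : vec R -> tensor4 R;
  rho : vec R -> R;
  rr : vec R -> R;
  Am : stime R -> tensor4 R;
  Ainv : stime R -> tensor4 R }.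

Record data (R : realType) := Data {
  ubar : stime R -> vec R;
  vbar : stime R -> vec R;
  Ebar : stime R -> tensor2 R;
  Wbar : stime R -> tensor2 R;
  bforce : stime R -> vec R;
  ub : stime R -> vec R;
  traction : stime R -> vec R;
  u0 : vec R -> vec R;
  v0 : vec R -> vec R;
  (* prescribed values of gamma and lambda at time T, of lambda on Gu and of
     mu n on Gs *)
  gammaT : vec R -> vec R;
  lambdaT : vec R -> vec R;
  lambdab : stime R -> vec R;
  mub : stime R -> vec R }.

Record dual (R : realType) := Dual {
  gam : stime R -> vec R;
  lam : stime R -> vec R;
  mu : stime R -> tensor2 R }.

Definition dual_sub (R : realType) (f g : dual R) : dual R :=
  Dual (fun p => gam f p - gam g p) (fun p => lam f p - lam g p)
       (fun p => mu f p - mu g p).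

Definition dual_smooth (R : realType) (Omega : set (vec R)) (T : R)
    (f : dual R) : Prop :=
  [/\ C2_near (ccyl Omega T) (gam f), C2_near (ccyl Omega T) (lam f) &
      C2_near (ccyl Omega T) (mu f)].

Definition smooth_coefficients (R : realType) (Omega : set (vec R)) (T : R)
    (c : coefficients R) : Prop :=
  [/\ C2_near_tensor4 (closure Omega) (Cm c),
      C2_near (closure Omega) (rho c : vec R -> R),
      C2_near (closure Omega) (rr c : vec R -> R),
      C2_near_tensor4 (ccyl Omega T) (Am c) &
      C2_near_tensor4 (ccyl Omega T) (Ainv c)].

Definition smooth_data (R : realType) (Omega : set (vec R)) (T : R)
    (d : data R) : Prop :=
  [/\ C2_near (ccyl Omega T) (ubar d), C2_near (ccyl Omega T) (vbar d),
      C2_near (ccyl Omega T) (Ebar d) & C2_near (ccyl Omega T) (Wbar d)].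

Definition admissible_coefficients (R : realType) (Omega : set (vec R)) (T : R)
    (c : coefficients R) : Prop :=
  [/\ forall x, closure Omega x -> minor_sym (Cm c x),
      forall x, closure Omega x -> 0 < rr c x &
      forall p, ccyl Omega T p ->
        [/\ major_sym (Am c p), posdef_sym (Am c p) &
            inverse_sym (Am c p) (Ainv c p)]].

Definition Ldu (R : realType) (f : dual R) (p : stime R) : vec R :=
  dt (gam f) p + divT (mu f) p.

Definition Ldv (R : realType) (c : coefficients R) (f : dual R) (p : stime R)
  : vec R := gam f p + rho c p.1 *: dt (lam f) p.

Definition LdE (R : realType) (c : coefficients R) (f : dual R) (p : stime R)
  : tensor2 R := sympart (mu f p) - app4 (tr4 (Cm c p.1)) (grad (lam f) p).

Definition ufield (R : realType) (d : data R) (f : dual R) (p : stime R)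
  : vec R := ubar d p - Ldu f p.

Definition vfield (R : realType) (c : coefficients R) (d : data R) (f : dual R)
    (p : stime R) : vec R := vbar d p - (rr c p.1)^-1 *: Ldv c f p.

Definition Efield (R : realType) (c : coefficients R) (d : data R) (f : dual R)
    (p : stime R) : tensor2 R := Ebar d p - app4 (Ainv c p) (LdE c f p).

Definition stress (R : realType) (c : coefficients R) (d : data R) (f : dual R)
    (p : stime R) : tensor2 R := app4 (Cm c p.1) (Efield c d f p).

(* Gs and Gu are the two parts of the boundary.  The conditions involving n are
   imposed where n exists. *)
Definition class_condition (R : realType) (Omega Gs Gu : set (vec R))
    (n : vec R -> vec R) (T : R) (c : coefficients R) (D : dual R) : Prop :=
  let Gsn := Gs `&` regular_boundary Omega in
  [/\ (forall x t, Gu x -> 0 < t < T -> Ldu D (x, t) = 0),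
      (forall x t, Gsn x -> 0 < t < T ->
         tapp (app4 (Cm c x) (app4 (Ainv c (x, t)) (LdE c D (x, t)))) (n x)
         = 0),
      (forall x, Omega x -> Ldu D (x, 0) = 0),
      (forall x, Omega x -> (rr c x)^-1 *: Ldv c D (x, 0) = 0) &
  [/\ (forall x, Omega x -> gam D (x, T) = 0 /\ lam D (x, T) = 0),
      (forall x t, Gu x -> 0 < t < T -> lam D (x, t) = 0),
      (forall x t, Gsn x -> 0 < t < T -> tapp (mu D (x, t)) (n x) = 0),
      (forall x t, Gsn x -> 0 < t < T ->
         tapp (skewpart (mu D (x, t))) (n x) = 0) &
      (forall x t, Gsn x -> 0 < t < T ->
         tapp (app4 (tr4 (Cm c x)) (grad (lam D) (x, t))
               - sympart (mu D (x, t))) (n x) = 0) /\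
      (forall x, Omega x -> Ldv c D (x, T) = 0)]].

Definition dual_solution (R : realType) (Omega Gs Gu : set (vec R))
    (n : vec R -> vec R) (T : R) (c : coefficients R) (d : data R)
    (f : dual R) : Prop :=
  let Gsn := Gs `&` regular_boundary Omega in
  [/\ (forall x t, Omega x -> 0 < t < T ->
         [/\ dt (ufield d f) (x, t) - vfield c d f (x, t) = 0,
             rho c x *: dt (vfield c d f) (x, t)
             - divT (stress c d f) (x, t) - bforce d (x, t) = 0 &
             grad (ufield d f) (x, t) - Efield c d f (x, t)
             - (Wbar d (x, t) - skewpart (mu f (x, t))) = 0]),
      (forall x t, Gu x -> 0 < t < T -> ufield d f (x, t) = ub d (x, t)),
      (forall x t, Gsn x -> 0 < t < T ->
         tapp (stress c d f (x, t)) (n x) = traction d (x, t)),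
      (forall x, Omega x ->
         ufield d f (x, 0) = u0 d x /\ vfield c d f (x, 0) = v0 d x) &
  [/\ (forall x, Omega x ->
         gam f (x, T) = gammaT d x /\ lam f (x, T) = lambdaT d x),
      (forall x t, Gu x -> 0 < t < T -> lam f (x, t) = lambdab d (x, t)) &
      (forall x t, Gsn x -> 0 < t < T ->
         tapp (mu f (x, t)) (n x) = mub d (x, t))]].

(* Main.v *)
Require Import Defs.
From mathcomp Require Import all_boot all_order all_algebra.
From mathcomp Require Import all_classical all_reals all_analysis.
From mathcomp Require Import ring lra measurable_realfun.

(** The difference [(gamma, lambda, mu)] of two solutions in the class solves a
    homogeneous linear system, and the point is that this system decouples into
    two problems of linear elastodynamics with zero data, one solved forward and
    one backward in time.

    Put [U = d_t gamma + div mu], [V = (gamma + rho d_t lambda) / r] and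
    [E = A^-1 (mu^(s) - C^T grad lambda)]. Subtracting the equations of the two
    solutions gives [d_t U = V], [rho d_t V = div (C E)] and
    [grad U = E + mu^(a)]. The tensor [E] is symmetric and [mu^(a)] is
    antisymmetric, so [E] is the strain of the displacement [U]. The conditions
    defining the class say that [U] and [V] vanish at time [0], that [U = 0] on
    the part [Gu] of the boundary and that [(C E) n = 0] on the part [Gs]. The
    energy, the integral of [rho V.V + E : C E], is conserved and vanishes at time
    [0]; as [rho > 0] and [C] is positive-definite, [V = 0] and [E = 0]. Therefore
    [U = 0] and [mu^(a) = 0].

    What remains is [gamma = - rho d_t lambda], [mu = C grad lambda] and
    [d_t gamma + div mu = 0]: the field [lambda] is itself the displacement of an
    elastodynamic problem, with zero data at time [T], [lambda = 0] on [Gu] and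
    [mu n = 0] on [Gs]. The same conservation law, started at [T], gives
    [lambda = 0], and then [gamma = 0] and [mu = 0].

    Both steps are instances of [energy_uniqueness]; they are carried out in the
    section on the homogeneous problem. Conservation of energy rests on
    [zero_mean_rate_eq0], which differentiates the energy under the integral sign,
    and on [flux_eq0], which shows that the boundary integral in the divergence
    theorem vanishes although the boundary conditions are only imposed on a dense
    part of the boundary. The field [U] is only of class C^1, so exchanging its
    time and space derivatives uses that these are C^1 functions again
    ([smooth1_derive_comm]). *)

Set Implicit Arguments.
Unset Strict Implicit.
Unset Printing Implicit Defensive.

Import Order.TTheory GRing.Theory Num.Theory.
Import numFieldNormedType.Exports.
Local Open Scope classical_set_scope.
Local Open Scope ring_scope.

(** * Functions of class C^1 near a point *)

(** Being of class C^1 near a point is used instead of being C^1 on an open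
    set: the rules of the calculus then need no bookkeeping of neighbourhoods,
    and [C1_near K f] means [smooth1 f] at every point of [K]. *)
Definition smooth1 (R : realType) (W X : normedModType R) (f : W -> X) (p : W)
  : Prop :=
  \forall q \near p, differentiable f q /\ forall w, {for q, continuous ('D_w f)}.

Section smooth1.
Context {R : realType} {W : normedModType R}.
Implicit Types (p w : W).

Lemma C1_near_smooth1 (X : normedModType R) (K : set W) (f : W -> X) p :
  C1_near K f -> K p -> smooth1 f p.
Proof.
move=> [U [oU KU [df cf]]] /KU Up.
have := open_nbhs_nbhs (conj oU Up); apply: filterS => q Uq.
by split; [exact: df|move=> w; exact: cf].
Qed.

Lemma C2_near_smooth1 (X : normedModType R) (K : set W) (f : W -> X) p :
  C2_near K f -> K p -> smooth1 f p.
Proof.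
by move=> [U [oU KU [f1 _]]] Kp; apply: (C1_near_smooth1 (K := K)) => //; exists U.
Qed.

Lemma C2_near_smooth1D (X : normedModType R) (K : set W) (f : W -> X) p w :
  C2_near K f -> K p -> smooth1 ('D_w f) p.
Proof.
move=> [U [oU KU [_ f1]]] Kp; apply: (C1_near_smooth1 (K := K)) => //.
by exists U; split.
Qed.

Lemma smooth1_C1_near (X : normedModType R) (K : set W) (f : W -> X) :
  (forall p, K p -> smooth1 f p) -> C1_near K f.
Proof.
move=> Kf; exists [set p | smooth1 f p]; split => //.
  rewrite openE => p /= fp; rewrite /interior.
  by move: fp; rewrite /smooth1 => /nbhs_interior.
by split=> [p /nbhs_singleton[]//|w p /nbhs_singleton[]].
Qed.

Lemma smooth1_diff (X : normedModType R) (f : W -> X) p :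
  smooth1 f p -> differentiable f p.
Proof. by move=> /nbhs_singleton[]. Qed.

Lemma smooth1_derivable (X : normedModType R) (f : W -> X) p w :
  smooth1 f p -> derivable f p w.
Proof. by move=> /smooth1_diff; exact: diff_derivable. Qed.

Lemma smooth1_continuous (X : normedModType R) (f : W -> X) p :
  smooth1 f p -> {for p, continuous f}.
Proof. by move=> /smooth1_diff; exact: differentiable_continuous. Qed.

Lemma smooth1_continuousD (X : normedModType R) (f : W -> X) p w :
  smooth1 f p -> {for p, continuous ('D_w f)}.
Proof. by move=> /nbhs_singleton[]. Qed.

Lemma smooth1_near (X : normedModType R) (f : W -> X) p :
  smooth1 f p -> \forall q \near p, smooth1 f q.
Proof. by move=> /nbhs_interior. Qed.

(** The rules of the calculus give the derivative by a formula [df] valid near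
    the point, so continuity of the derivative is continuity of the formula. *)
Lemma smooth1_intro (X : normedModType R) (f : W -> X) (df : W -> W -> X) p :
  (\forall q \near p, [/\ differentiable f q, forall w, 'D_w f q = df w q &
     forall w, {for q, continuous (df w)}]) -> smooth1 f p.
Proof.
move=> /nbhs_interior fdf; apply: filterS fdf => q; rewrite /interior /= => fq.
have [dfq eq cq] := nbhs_singleton fq.
split=> // w; rewrite /prop_for /continuous_at eq.
apply: cvg_trans (cq w); apply: near_eq_cvg.
by apply: filterS fq => ? [].
Qed.

Lemma smooth1_cst (X : normedModType R) (a : X) p : smooth1 (fun=> a) p.
Proof.
apply: (smooth1_intro (df := fun _ _ => 0)); apply: nearW => q; split.
- exact: differentiable_cst.
- by move=> w; exact: derive_cst.
- by move=> w; exact: cst_continuous.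
Qed.

Lemma smooth1D (X : normedModType R) (f g : W -> X) p :
  smooth1 f p -> smooth1 g p -> smooth1 (fun q => f q + g q) p.
Proof.
move=> sf sg.
apply: (smooth1_intro (df := fun w q => 'D_w f q + 'D_w g q)).
apply: filterS2 sf sg => q [df cf] [dg cg].
split=> [|w|w]; first exact: differentiableD.
  by apply: deriveD; exact: diff_derivable.
by apply: cvgD; [exact: cf|exact: cg].
Qed.

Lemma smooth1N (X : normedModType R) (f : W -> X) p :
  smooth1 f p -> smooth1 (fun q => - f q) p.
Proof.
move=> sf; apply: (smooth1_intro (df := fun w q => - 'D_w f q)).
apply: filterS sf => q [df cf]; split=> [|w|w]; first exact: differentiableN.
  by apply: deriveN; exact: diff_derivable.
by apply: cvgN; exact: cf.
Qed.

Lemma smooth1B (X : normedModType R) (f g : W -> X) p :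
  smooth1 f p -> smooth1 g p -> smooth1 (fun q => f q - g q) p.
Proof. by move=> sf sg; exact/smooth1D/smooth1N. Qed.

Lemma smooth1_sum (X : normedModType R) (I : Type) (r : seq I)
    (f : I -> W -> X) p :
  (forall i, smooth1 (f i) p) -> smooth1 (fun q => \sum_(i <- r) f i q) p.
Proof.
move=> sf; elim: r => [|i r IH].
  by under eq_fun do rewrite big_nil; exact: smooth1_cst.
by under eq_fun do rewrite big_cons; exact: smooth1D.
Qed.

Lemma smooth1M (f g : W -> R) p :
  smooth1 f p -> smooth1 g p -> smooth1 (fun q => f q * g q) p.
Proof.
move=> sf sg.
apply: (smooth1_intro (df := fun w q => f q * 'D_w g q + g q * 'D_w f q)).
apply: filterS2 sf sg => q [df cf] [dg cg].
split=> [|w|w]; first exact: differentiableM.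
  by apply: (deriveM (f := f) (g := g)); exact: diff_derivable.
by apply: cvgD; apply: cvgM; [exact: differentiable_continuous|exact: cg
  |exact: differentiable_continuous|exact: cf].
Qed.

Lemma smooth1V (f : W -> R) p :
  f p != 0 -> smooth1 f p -> smooth1 (fun q => (f q)^-1) p.
Proof.
move=> fp0 sf.
apply: (smooth1_intro (df := fun w q => - (f q) ^- 2 *: 'D_w f q)).
have f0 : \forall q \near p, f q != 0.
  have /(_ [set x | x != 0]) := smooth1_continuous sf; apply.
  exact: (open_nbhs_nbhs (conj (@open_neq R 0) fp0)).
apply: filterS2 f0 sf => q fq0 [df cf].
have cfq := differentiable_continuous df.
split=> [|w|w]; first exact: differentiableV.
  by apply: (deriveV (f := f)) => //; exact: diff_derivable.
apply: cvgZ (cf w); apply: cvgN; apply: cvgV; first by rewrite expf_neq0.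
by apply: cvgM.
Qed.

Lemma smooth1Zl (X : normedModType R) (f : W -> R) (a : X) p :
  smooth1 f p -> smooth1 (fun q => f q *: a) p.
Proof.
move=> sf; apply: (smooth1_intro (df := fun w q => 'D_w f q *: a)).
apply: filterS sf => q [df cf]; split=> [|w|w].
- exact: differentiableZl.
- have dfa : differentiable (fun q => f q *: a) q by exact: differentiableZl.
  by rewrite deriveE// diffZl// deriveE.
- exact: (cvgZ (cf w) (cvg_cst a)).
Qed.

Lemma derive_coord m n (f : W -> 'M[R]_(m, n)) i j p w :
  derivable f p w -> 'D_w (fun q => f q i j) p = ('D_w f p) i j.
Proof. by move=> df; rewrite derive_mx// mxE. Qed.

Lemma smooth1_coord m n (f : W -> 'M[R]_(m.+1, n.+1)) i j p :
  smooth1 f p -> smooth1 (fun q => f q i j) p.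
Proof.
move=> sf; apply: (smooth1_intro (df := fun w q => ('D_w f q) i j)).
apply: filterS sf => q [df cf]; split=> [|w|w].
- exact: (differentiable_comp df (differentiable_coord _ _ _)).
- by rewrite derive_coord//; exact: diff_derivable.
- apply: (@continuous_comp _ _ _ ('D_w f) (fun M : 'M[R]__ => M i j : R) q (cf w)).
  exact: coord_continuous.
Qed.

Lemma smooth1_mx m n (f : W -> 'M[R]_(m.+1, n.+1)) p :
  (forall i j, smooth1 (fun q => f q i j) p) -> smooth1 f p.
Proof.
move=> sf; have -> : f = (fun q => \sum_(ij <- enum predT)
    f q ij.1 ij.2 *: (delta_mx ij.1 ij.2 : 'M[R]_(m.+1, n.+1))).
  apply/funext => q; rewrite [LHS]matrix_sum_delta big_enum pair_big /=.
  by apply: eq_bigl.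
apply: smooth1_sum => ij; exact: (smooth1Zl _ (sf ij.1 ij.2)).
Qed.

End smooth1.

(** Precomposition with an affine map covers restriction to a line, to a fixed
    time or to a fixed position, as well as the projection to space. *)
Section affine.
Context {R : realType} {W W' X : normedModType R}.
Variables (L : W -> W') (l : W -> W').
Hypothesis (Ll : forall (h : R) w p, L (h *: w + p) = h *: l w + L p).

Lemma derive_affine (f : W' -> X) p w :
  'D_w (fun q => f (L q)) p = 'D_(l w) f (L p).
Proof.
rewrite /derive; set F := (X in lim (X @ _)); set G := (X in _ = lim (X @ _)).
by have -> : F = G by apply/funext => h; rewrite /F /G /= Ll.
Qed.

Lemma derivable_affine (f : W' -> X) p w :
  derivable f (L p) (l w) -> derivable (fun q => f (L q)) p w.
Proof.
rewrite /derivable; set F := (X in cvg (X @ _)).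
set G := (X in _ -> cvg (X @ _)).
by have -> : F = G by apply/funext => h; rewrite /F /G /= Ll.
Qed.

Hypothesis (Ld : forall p, differentiable L p).

Lemma smooth1_affine (f : W' -> X) p :
  smooth1 f (L p) -> smooth1 (fun q => f (L q)) p.
Proof.
move=> sf; apply: (smooth1_intro (df := fun w q => 'D_(l w) f (L q))).
have Lc q := differentiable_continuous (Ld q).
have : \forall q \near p, differentiable f (L q) /\
    forall w, {for L q, continuous ('D_w f)} := Lc p _ sf.
apply: filterS => q [df cf]; split=> [|w|w].
- exact: (differentiable_comp (Ld q) df).
- exact: derive_affine.
- exact: (continuous_comp (Lc q) (cf (l w))).
Qed.

End affine.

Section near.
Context {R : realType} {W X : normedModType R}.

(** The differential is the linear map of an expansion around the point, and
    that expansion only involves nearby values. *)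
Lemma near_differentiable (f g : W -> X) p :
  (\forall q \near p, f q = g q) -> differentiable f p -> differentiable g p.
Proof.
move=> fg df; have [cdf fo] := (diff_locallyP _ _).1 df.
have go : g \o shift p = cst (g p) + 'd f p +o_ 0 id.
  apply/eqaddoP => e e0; have /eqaddoP/(_ e e0) := fo.
  have fg0 : \forall h \near (0 : W), f (h + p) = g (h + p).
    by move: fg; rewrite (near_shift 0) => /=; apply: filterS => h; rewrite subr0.
  apply: filterS2 fg0 => h /= fgh.
  by rewrite !fctE /= fgh (nbhs_singleton fg).
by apply/diff_locallyP; rewrite (diff_unique cdf go).
Qed.

Lemma near_smooth1 (f g : W -> X) p :
  (\forall q \near p, f q = g q) -> smooth1 f p -> smooth1 g p.
Proof.
move=> /nbhs_interior fg sf; apply: (smooth1_intro (df := fun w => 'D_w f)).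
apply: filterS2 fg sf => q fgq [df cf]; split=> [|w|//].
  exact: near_differentiable df.
by apply/esym/near_eq_derive.
Qed.

End near.

Section derive_rules.
Context {R : realType} {W : normedModType R}.
Implicit Types (f g : W -> R) (p w : W).

Lemma derive_smoothD (X : normedModType R) (f g : W -> X) p w :
  smooth1 f p -> smooth1 g p ->
  'D_w (fun q => f q + g q) p = 'D_w f p + 'D_w g p.
Proof.
move=> sf sg; exact: (deriveD (smooth1_derivable sf) (smooth1_derivable sg)).
Qed.

Lemma derive_smoothB (X : normedModType R) (f g : W -> X) p w :
  smooth1 f p -> smooth1 g p ->
  'D_w (fun q => f q - g q) p = 'D_w f p - 'D_w g p.
Proof.
move=> sf sg; exact: (deriveB (smooth1_derivable sf) (smooth1_derivable sg)).
Qed.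

Lemma derive_smoothM f g p w : smooth1 f p -> smooth1 g p ->
  'D_w (fun q => f q * g q) p = f p * 'D_w g p + g p * 'D_w f p.
Proof.
move=> sf sg; exact: (deriveM (smooth1_derivable sf) (smooth1_derivable sg)).
Qed.

Lemma derive_smooth_sum (I : Type) (r : seq I) (f : I -> W -> R) p w :
  (forall i, smooth1 (f i) p) ->
  'D_w (fun q => \sum_(i <- r) f i q) p = \sum_(i <- r) 'D_w (f i) p.
Proof.
move=> sf; elim: r => [|i r IH].
  rewrite big_nil (_ : (fun q => _) = cst 0) ?derive_cst//.
  by apply/funext => q; rewrite big_nil.
rewrite big_cons -IH -derive_smoothD//; last exact: smooth1_sum.
by congr ('D_w _ p); apply/funext => q; rewrite big_cons.
Qed.

End derive_rules.

Section slices.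
Context {R : realType} {X : normedModType R}.

Lemma smooth1_space (f : vec R -> X) (p : stime R) :
  smooth1 f p.1 -> smooth1 (fun q : stime R => f q.1) p.
Proof.
apply: (smooth1_affine (l := fst)) => // q.
apply: (@linear_differentiable R (vec R * R)%type (vec R) fst) => ?.
exact: cvg_fst.
Qed.

Lemma derive_space_dirt (f : vec R -> X) (p : stime R) :
  dt (fun q => f q.1) p = 0.
Proof. by rewrite /dt (derive_affine (l := fst))//= derive0. Qed.

Lemma slice_affine (t : R) (h : R) (w x : vec R) :
  ((h *: w + x, t) : stime R) = h *: ((w, 0) : stime R) + (x, t).
Proof. by congr (_, _); rewrite /= scaler0 add0r. Qed.

Lemma smooth1_slice (f : stime R -> X) x t :
  smooth1 f (x, t) -> smooth1 (fun y : vec R => f (y, t)) x.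
Proof.
apply: (smooth1_affine (L := fun y => (y, t)) (l := fun w => (w, 0))) => [*|y].
  exact: slice_affine.
exact: differentiable_pair.
Qed.

Lemma derive_slice (f : stime R -> X) x t j :
  'D_(delta_mx 0 j : vec R) (fun y : vec R => f (y, t)) x
  = 'D_(dirx R j) f (x, t).
Proof.
by rewrite (derive_affine (L := fun y => (y, t)) (l := fun w => (w, 0)))// => *;
  exact: slice_affine.
Qed.

Lemma slicet_affine (x : vec R) (h w t : R) :
  ((x, h *: w + t) : stime R) = h *: ((0, w) : stime R) + (x, t).
Proof. by congr (_, _); rewrite /= scaler0 add0r. Qed.

Lemma smooth1_slicet (f : stime R -> X) x t :
  smooth1 f (x, t) -> smooth1 (fun s : R => f (x, s)) t.
Proof.
apply: (smooth1_affine (L := fun s => (x, s)) (l := fun w => (0, w))) => [*|s].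
  exact: slicet_affine.
exact: differentiable_pair.
Qed.

Lemma derive_slicet (f : stime R -> X) x t :
  'D_1 (fun s : R => f (x, s)) t = dt f (x, t).
Proof.
by rewrite (derive_affine (L := fun s => (x, s)) (l := fun w => (0, w)))// => *;
  exact: slicet_affine.
Qed.

End slices.

(** * Equality of mixed derivatives *)

Section schwarz.
Context {R : realType} {W : normedModType R}.
Implicit Types (f : W -> R) (p q a b : W).

Let line_affine a q (h w s : R) :
  (h *: w + s) *: a + q = h *: (w *: a) + (s *: a + q).
Proof. by rewrite scalerDl scalerA addrA. Qed.

Lemma line_mvt f q a (h : R) : 0 < h ->
  (forall s : R, 0 <= s <= h -> derivable f (s *: a + q) a) ->
  exists2 s, 0 <= s <= h & f (h *: a + q) - f q = h * 'D_a f (s *: a + q).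
Proof.
move=> h0 df.
have aff := @line_affine a q.
have dF (s : R) : 0 <= s <= h -> is_derive s 1 (fun s : R => f (s *: a + q))
    ('D_a f (s *: a + q)).
  move=> sh; apply: DeriveDef.
    have := derivable_affine (L := fun s : R => s *: a + q) (l := fun w : R => w *: a)
      aff (f := f) (p := s) (w := 1).
    rewrite scale1r; apply; exact: df.
  rewrite (derive_affine (L := fun s : R => s *: a + q) (l := fun w : R => w *: a))//.
  by rewrite scale1r.
have [||s] := @MVT R (fun s : R => f (s *: a + q)) (fun s => 'D_a f (s *: a + q)) 0 h h0.
- move=> s; rewrite in_itv/= => /andP[s0 sh]; by apply: dF; rewrite !ltW.
- apply: derivable_within_continuous => s; rewrite in_itv/= => sh.
  by have [] := dF _ sh.
rewrite in_itv/= => /andP[s0 sh]; rewrite scale0r add0r subr0 mulrC => e.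
by exists s => //; rewrite (ltW s0) ltW.
Qed.

(** The mean value theorem is applied along [a] to the increment of [f] along
    [b], and then along [b] to the derivative of [f] along [a]. *)
Lemma second_difference f p a b (h : R) : 0 < h ->
  (forall s t : R, 0 <= s <= h -> 0 <= t <= h ->
     derivable f (s *: a + (t *: b + p)) a /\
     derivable ('D_a f) (t *: b + (s *: a + p)) b) ->
  exists s t, [/\ 0 <= s <= h, 0 <= t <= h &
    f (h *: a + (h *: b + p)) - f (h *: a + p) - f (h *: b + p) + f p =
    h * (h * 'D_b ('D_a f) (t *: b + (s *: a + p)))].
Proof.
move=> h0 df.
have aff (s t : R) : t *: b + (s *: a + p) = s *: a + (t *: b + p).
  by rewrite addrCA.
have h0h : 0 <= h <= h by rewrite (ltW h0) lexx.
have z0h : (0 : R) <= 0 <= h by rewrite lexx (ltW h0).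
have d1 s : 0 <= s <= h -> derivable (fun q => f (h *: b + q)) (s *: a + p) a.
  move=> sh; apply: (derivable_affine (L := fun q => h *: b + q) (l := id)).
    by move=> *; rewrite addrCA.
  by rewrite aff; have [] := df s h sh h0h.
have d2 s : 0 <= s <= h -> derivable f (s *: a + p) a.
  by move=> sh; have [+ _] := df s 0 sh z0h; rewrite scale0r add0r.
have [s sh es] := line_mvt (f := fun q => f (h *: b + q) - f q) h0
  (fun s sh => derivableB (d1 s sh) (d2 s sh)).
have [t th et] := line_mvt (f := 'D_a f) (q := s *: a + p) (a := b) h0
  (fun t th => (df s t sh th).2).
exists s, t; split=> //; rewrite -et.
have -> : 'D_a f (h *: b + (s *: a + p)) - 'D_a f (s *: a + p) =
  'D_a (fun q => f (h *: b + q) - f q) (s *: a + p).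
  rewrite [RHS](deriveB (d1 s sh) (d2 s sh)).
  rewrite (derive_affine (L := fun q => h *: b + q) (l := id))//.
  by move=> *; rewrite addrCA.
by rewrite -es (aff h h); ring.
Qed.

Lemma near_dist f p (e : R) : {for p, continuous f} -> 0 < e ->
  \forall q \near p, `|f p - f q| < e.
Proof. by move=> /cvgrPdist_lt + e0; apply. Qed.

(** The second difference is symmetric in [a] and [b], so both mixed
    derivatives take the same value at some points arbitrarily close to [p];
    continuity carries the equality over to [p]. *)
Lemma derive_comm f p a b :
  (\forall q \near p, [/\ derivable f q a, derivable f q b,
     derivable ('D_a f) q b & derivable ('D_b f) q a]) ->
  {for p, continuous ('D_b ('D_a f))} -> {for p, continuous ('D_a ('D_b f))} ->
  'D_b ('D_a f) p = 'D_a ('D_b f) p.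
Proof.
move=> df cba cab.

set A := 'D_b ('D_a f) p; set B := 'D_a ('D_b f) p.
apply/eqP; apply: contraT => AB.
pose e := `|A - B| / 2.
have e0 : 0 < e by rewrite divr_gt0// normr_gt0 subr_eq0.
have nA : \forall q \near p, `|A - 'D_b ('D_a f) q| < e := near_dist cba e0.
have nB : \forall q \near p, `|B - 'D_a ('D_b f) q| < e := near_dist cab e0.
have [r /= r0 rQ] := (nbhs_ballP _ _).1 (filterI df (filterI nA nB)).
pose h := r / (`|a| + `|b| + 1).
have ab1 : 0 < `|a| + `|b| + 1 by rewrite ltr_wpDl// addr_ge0.
have h0 : 0 < h by rewrite divr_gt0.
have good s t : 0 <= s <= h -> 0 <= t <= h -> ball p r (t *: b + (s *: a + p)).
  move=> /andP[s0 sh] /andP[t0 th]; rewrite -ball_normE /ball_ /= addrA opprD addrCA subrr addr0.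
  rewrite normrN (le_lt_trans (ler_normD _ _))// !normrZ !ger0_norm//.
  rewrite (@le_lt_trans _ _ (h * (`|a| + `|b|)))//.
    by rewrite mulrDr addrC lerD// ler_wpM2r.
  by rewrite /h mulrAC ltr_pdivrMr// ltr_pM2l// ltrDl.
have swap (s t : R) : t *: b + (s *: a + p) = s *: a + (t *: b + p).
  by rewrite addrCA.
have rd q : ball p r q -> [/\ derivable f q a, derivable f q b,
     derivable ('D_a f) q b & derivable ('D_b f) q a].
  by move=> /rQ -[].
(* the same second difference, expanded in the two possible orders *)
have [s t sh th|s1 [t1 [s1h t1h e1]]] := @second_difference f p a b h h0.
  have [da _ dab _] := rd _ (good _ _ sh th).
  by split; [rewrite -swap; exact: da|exact: dab].
have [s t sh th|t2 [s2 [t2h s2h e2]]] := @second_difference f p b a h h0.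
  have [_ db _ dba] := rd _ (good _ _ th sh).
  by split; [exact: db|rewrite -swap; exact: dba].
have [_ [qA _]] := rQ _ (good _ _ s1h t1h).
have [_ [_ qB]] := rQ _ (good _ _ s2h t2h).
rewrite -(swap s2 t2) in e2.
have E : 'D_b ('D_a f) (t1 *: b + (s1 *: a + p)) =
         'D_a ('D_b f) (t2 *: b + (s2 *: a + p)).
  apply: (mulfI (lt0r_neq0 h0)); apply: (mulfI (lt0r_neq0 h0)).
  apply: etrans (esym e1) (etrans _ e2).
  by congr (_ + _); have -> := swap h h; exact: addrAC.
suff : `|A - B| < e + e by rewrite /e -splitr ltxx.
set x := 'D_b _ _ in qA E; set y := 'D_a _ _ in qB E.
apply: le_lt_trans (ler_distD x A B) _.
by apply: ltrD; [exact: qA|rewrite E distrC; exact: qB].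
Qed.

(** Equality of mixed derivatives for a function whose first derivatives are
    only known near [p], through C^1 formulas [g] and [k]. *)
Lemma smooth1_derive_comm f g k p a b : smooth1 f p ->
  (\forall q \near p, 'D_a f q = g q) -> (\forall q \near p, 'D_b f q = k q) ->
  smooth1 g p -> smooth1 k p -> 'D_b g p = 'D_a k p.
Proof.
move=> sf /nbhs_interior fg /nbhs_interior fk sg sk.
have eqg : \forall q \near p, 'D_b ('D_a f) q = 'D_b g q.
  by apply: filterS fg => q fgq; exact: near_eq_derive.
have eqk : \forall q \near p, 'D_a ('D_b f) q = 'D_a k q.
  by apply: filterS fk => q fkq; exact: near_eq_derive.
rewrite -(nbhs_singleton eqg) -(nbhs_singleton eqk); apply: derive_comm.
- have d3 : \forall q \near p,
      [/\ differentiable f q, differentiable g q & differentiable k q].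
    by apply: filterS3 sf sg sk => q [? _] [? _] [? _].
  apply: filterS3 d3 fg fk => q [df dg dk] fgq fkq; split.
  + exact: diff_derivable.
  + exact: diff_derivable.
  + apply: (near_eq_derivable (f := g)); last exact: diff_derivable.
    by apply: filterS fgq => ? /esym.
  + apply: (near_eq_derivable (f := k)); last exact: diff_derivable.
    by apply: filterS fkq => ? /esym.
- rewrite /prop_for /continuous_at (nbhs_singleton eqg).
  apply: cvg_trans (smooth1_continuousD (w := b) sg); apply: near_eq_cvg.
  by apply: filterS eqg => ? ->.
- rewrite /prop_for /continuous_at (nbhs_singleton eqk).
  apply: cvg_trans (smooth1_continuousD (w := a) sk); apply: near_eq_cvg.
  by apply: filterS eqk => ? ->.
Qed.

End schwarz.

(** * Lebesgue measure on row vectors *)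

Section volume.
Context {R : realType}.
Implicit Types (A Omega : set (vec R)) (p : meas3 R).

Definition box (l u : meas3 R) : set (meas3 R) :=
  `]l.1.1, u.1.1[%classic `*` `]l.1.2, u.1.2[%classic `*` `]l.2, u.2[%classic.

Lemma measurable_box l u : measurable (box l u).
Proof. by apply: measurableX => //; apply: measurableX. Qed.

Lemma volume_box (l u : meas3 R) :
  l.1.1 < u.1.1 -> l.1.2 < u.1.2 -> l.2 < u.2 ->
  @volume R (box l u) =
    ((u.1.1 - l.1.1) * (u.1.2 - l.1.2) * (u.2 - l.2))%:E.
Proof.
move=> l1 l2 l3; rewrite /volume /box.
have mB : measurable (`]l.1.1, u.1.1[ `*` `]l.1.2, u.1.2[ : set (_ * _)).
  exact: measurableX.
apply: etrans (product_measure1E (product_measure1 (@lebesgue_measure R)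
  (@lebesgue_measure R)) (@lebesgue_measure R) mB (measurable_itv _)) _.
apply: (etrans (congr1 (fun z => (z * _)%E) (product_measure1E
  (@lebesgue_measure R) (@lebesgue_measure R) (measurable_itv _) (measurable_itv _)))).
have itvE (a b : R) : a < b -> lebesgue_measure (`]a, b[ : set R) = (b - a)%:E.
  by move=> ab; rewrite lebesgue_measure_itv/= lte_fin ab.
rewrite !EFinM.
exact: (congr2 mule (congr2 mule (itvE _ _ l1) (itvE _ _ l2)) (itvE _ _ l3)).
Qed.

Lemma pt_coords p : [/\ pt p 0 (inord 0) = p.1.1, pt p 0 (inord 1) = p.1.2 &
  pt p 0 (inord 2) = p.2].
Proof. by split; rewrite mxE !inordK. Qed.

Lemma pt_norm p (e : R) :
  `|p.1.1| < e -> `|p.1.2| < e -> `|p.2| < e -> `|pt p| < e.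
Proof.
move=> h1 h2 h3; rewrite /Num.Def.normr/= mx_normrE; apply: bigmax_lt => /=.
  exact: le_lt_trans h1.
move=> [i j] _; rewrite mxE/=.
by case: j => -[|[|[|//]]].
Qed.

Lemma pt_surj (x : vec R) : exists p, x = pt p.
Proof.
exists (x 0 (inord 0), x 0 (inord 1), x 0 (inord 2)).
apply/rowP => j; rewrite mxE /=.
by case: j => -[|[|[|//]]] j3 /=; congr (x 0 _); apply: val_inj; rewrite /= inordK.
Qed.

Lemma pt_sub p q : pt p - pt q = pt (p.1.1 - q.1.1, p.1.2 - q.1.2, p.2 - q.2).
Proof. by apply/rowP => j; rewrite !mxE/=; case: j => -[|[|[|//]]]. Qed.

Lemma open_box A p : open A -> A (pt p) -> exists2 e : R, 0 < e &
  forall q, `|p.1.1 - q.1.1| < e -> `|p.1.2 - q.1.2| < e -> `|p.2 - q.2| < e ->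
    A (pt q).
Proof.
move=> oA Ap; have [e /= e0 eA] := (nbhs_ballP _ _).1 (open_nbhs_nbhs (conj oA Ap)).
exists e => // q h1 h2 h3; apply: eA; rewrite -ball_normE /ball_ /= pt_sub.
exact: pt_norm.
Qed.

(** An open set is the countable union of the boxes with rational corners that
    it contains. *)
Lemma measurable_pt_open A : open A -> measurable (@pt R @^-1` A : set (meas3 R)).
Proof.
move=> oA.
pose rq (q : rat * rat * rat) : meas3 R := (ratr q.1.1, ratr q.1.2, ratr q.2).
pose F (i : (rat * rat * rat) * (rat * rat * rat)) :=
  [set x | box (rq i.1) (rq i.2) x /\ box (rq i.1) (rq i.2) `<=` @pt R @^-1` A].
suff -> : @pt R @^-1` A = \bigcup_i F i.
  apply: countable_bigcupT_measurable => [|i]; first exact: countableP.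
  rewrite /F.
  have [h|h] := pselect (box (rq i.1) (rq i.2) `<=` @pt R @^-1` A).
    rewrite (_ : [set _ | _] = box (rq i.1) (rq i.2)); first exact: measurable_box.
    by apply/seteqP; split => x //= [].
  rewrite (_ : [set _ | _] = set0)//.
  by apply/seteqP; split => x //= [].
apply/seteqP; split => [p /= Ap|p [i _ [ip iA]]]; last exact: iA.
have [e e0 eA] := open_box oA Ap.
have rl (x : R) : exists q : rat, x - e < ratr q < x.
  have /rat_in_itvoo[q] : x - e < x by rewrite ltrBlDr ltrDl.
  by rewrite in_itv => qx; exists q.
have ru (x : R) : exists q : rat, x < ratr q < x + e.
  have /rat_in_itvoo[q] : x < x + e by rewrite ltrDl.
  by rewrite in_itv => qx; exists q.
have [a1 /andP[a1l a1u]] := rl p.1.1; have [b1 /andP[b1l b1u]] := ru p.1.1.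
have [a2 /andP[a2l a2u]] := rl p.1.2; have [b2 /andP[b2l b2u]] := ru p.1.2.
have [a3 /andP[a3l a3u]] := rl p.2; have [b3 /andP[b3l b3u]] := ru p.2.
exists ((a1, a2, a3), (b1, b2, b3)) => //; split.
  by rewrite /box /= !in_itv /= a1u a2u a3u b1l b2l b3l.
move=> q; rewrite /box /= !in_itv /= => -[[/andP[q1l q1u] /andP[q2l q2u]] /andP[q3l q3u]].
by apply: eA; rewrite ltr_norml; apply/andP; split; lra.
Qed.

Lemma volume_pt_bounded A : open A -> bounded_set A ->
  (@volume R (@pt R @^-1` A) < +oo)%E.
Proof.
move=> oA [M0 [_ bA]].
pose M := Num.max 1 (M0 + 1).
have M0' : 0 < M by rewrite lt_max ltr01.
have Ax x : A x -> `|x| <= M.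
  by apply: bA; rewrite lt_max ltrDl ltr01 orbT.
pose u : meas3 R := (M + 1, M + 1, M + 1); pose l : meas3 R := (- (M + 1), - (M + 1), - (M + 1)).
apply: (@le_lt_trans _ _ (@volume R (box l u))).
  apply: le_measure; rewrite ?inE.
  - exact: measurable_pt_open.
  - exact: measurable_box.
  - move=> p /= /Ax; rewrite /Num.Def.normr/= mx_normrE => pM.
    have c j : `|pt p 0 j| < M + 1.
      rewrite (le_lt_trans _ (ltr_pwDr _ pM))//.
      exact: (le_bigmax _ _ (0 : 'I_1, j)).
    have [c1 c2 c3] := pt_coords p.
    move: (c (inord 0)) (c (inord 1)) (c (inord 2)); rewrite c1 c2 c3 !ltr_norml.
    by move=> h1 h2 h3; rewrite /box /= !in_itv /=.
have lu : - (M + 1) < M + 1 by lra.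
by rewrite volume_box//= ltry.
Qed.

Lemma measurable_pt_fun A (g : vec R -> R) : open A ->
  (forall x, A x -> {for x, continuous g}) ->
  measurable_fun (@pt R @^-1` A : set (meas3 R)) (fun p => g (pt p)).
Proof.
move=> oA cg; apply: (measurability _ (RGenOpens.measurableE R)).
move=> _ [_ [a [b ->] <-]].
rewrite (_ : _ `&` _ = @pt R @^-1` (A `&` g @^-1` `]a, b[)); last first.
  by apply/seteqP; split.
apply: measurable_pt_open.
rewrite openE => x [Ax gx]; rewrite /interior.
apply: filterI; first exact: open_nbhs_nbhs.
by apply: (cg x Ax); apply: open_nbhs_nbhs; split => //; exact: interval_open.
Qed.

End volume.

(** * Nonnegative densities whose total rate vanishes *)

Section density.
Context {R : realType}.

(** Identities between continuous fields are only known inside the cylinder, or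
    on a dense part of the boundary; this carries them to the closure. *)
Lemma continuous_eq0_closure (W : normedModType R) (A : set W) (f : W -> R) p :
  {for p, continuous f} -> (forall q, A q -> f q = 0) -> closure A p -> f p = 0.
Proof.
move=> cf f0 clp; apply/eqP; apply: contraT => fp.
have /(_ [set z | z != 0]) fc := cf.
have [|q [/f0 fq]] := clp (f @^-1` [set z | z != 0]).
  by apply: fc; apply: open_nbhs_nbhs; split => //; exact: open_neq.
by rewrite /= fq eqxx.
Qed.

Lemma closure_cyl (Omega : set (vec R)) (T : R) : 0 < T ->
  ccyl Omega T `<=` closure (Omega `*` `]0, T[).
Proof.
move=> T0 [x t] [/= clx /andP[t0 tT]] N [[N1 N2] /= [n1 n2] NN].
have [y [Oy N1y]] := clx _ n1.
have [s [sT N2s]] : (`]0, T[ `&` N2) !=set0.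
  have [e /= e0 eN2] := (nbhs_ballP _ _).1 n2.
  pose r := Num.min (T / 4) (e / 2).
  have r0 : 0 < r by rewrite lt_min !divr_gt0.
  have rT : r <= T / 4 by rewrite ge_min lexx.
  have re : r < e.
    by rewrite (@le_lt_trans _ _ (e / 2))// ?ge_min ?lexx ?orbT// ltr_pdivrMr//; lra.
  have [h|h] := leP t (T / 2).
    exists (t + r); split; first by rewrite /= in_itv/=; apply/andP; split; lra.
    by apply: eN2; rewrite -ball_normE /ball_ /= opprD addrA subrr sub0r normrN gtr0_norm.
  exists (t - r); split; first by rewrite /= in_itv/=; apply/andP; split; lra.
  by apply: eN2; rewrite -ball_normE /ball_ /= opprB addrC subrK gtr0_norm.
by exists (y, s); split => //; apply: NN.
Qed.

Lemma cyl_continuous_eq0 (Omega : set (vec R)) (T : R)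
    (f : stime R -> R) : 0 < T ->
  (forall p, ccyl Omega T p -> {for p, continuous f}) ->
  (forall x t, Omega x -> 0 < t < T -> f (x, t) = 0) ->
  forall p, ccyl Omega T p -> f p = 0.
Proof.
move=> T0 cf f0 p Cp; apply: (continuous_eq0_closure (A := Omega `*` `]0, T[)).
- exact: cf.
- by move=> [x t] [/= Ox]; rewrite in_itv/=; exact: f0.
- exact: closure_cyl.
Qed.

Lemma cyl_continuous_eq (Omega : set (vec R)) (T : R) (f g : stime R -> R) :
  0 < T ->
  (forall p, ccyl Omega T p -> {for p, continuous f}) ->
  (forall p, ccyl Omega T p -> {for p, continuous g}) ->
  (forall x t, Omega x -> 0 < t < T -> f (x, t) = g (x, t)) ->
  forall p, ccyl Omega T p -> f p = g p.
Proof.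
move=> T0 cf cg fg p Cp; apply/subr0_eq.
apply: (cyl_continuous_eq0 (f := fun p => f p - g p) T0 _ _ Cp) => [q Cq|x t Ox tT].
  exact: (cvgB (cf q Cq) (cg q Cq)).
by rewrite fg// subrr.
Qed.

End density.

Section evolution.
Context {R : realType}.
Variables (Omega : set (vec R)) (T : R).
Hypotheses (oO : open Omega) (bO : bounded_set Omega).

(** A positive value of [g] persists on a box, and boxes have positive volume. *)
Lemma integral_eq0_continuous (g : vec R -> R) :
  (forall x, Omega x -> {for x, continuous g}) ->
  (forall x, Omega x -> 0 <= g x) ->
  (\int[@volume R]_(p in @pt R @^-1` Omega) (g (pt p))%:E = 0)%E ->
  forall x, Omega x -> g x = 0.
Proof.
move=> cg g0 ig x Ox.
have mO := measurable_pt_open oO.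
have mg := measurable_pt_fun oO cg.
pose mu := product_measure1 (product_measure1 (@lebesgue_measure R)
  (@lebesgue_measure R)) (@lebesgue_measure R).
have [] : ae_eq mu (@pt R @^-1` Omega) (fun p => (g (pt p))%:E) (cst 0%E).
  apply/ae_eq_integral_abs => //; first exact/measurable_EFinP.
  rewrite -[RHS]ig; apply: eq_integral => p; rewrite inE => /g0 gp.
  by rewrite gee0_abs.
move=> N [mN N0 sub].
apply/eqP; apply: contraT => gx.
have oG : open (Omega `&` [set y | g y != 0]).
  rewrite openE => y [Oy gy]; rewrite /interior.
  apply: filterI; first exact: open_nbhs_nbhs.
  have /(_ [set z | z != 0]) := cg y Oy; apply.
  by apply: open_nbhs_nbhs; split => //; exact: open_neq.
have [p xp] := pt_surj x.
have /open_box[//|e e0 eG] : (Omega `&` [set y | g y != 0]) (pt p).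
  by rewrite -xp; split.
pose l : meas3 R := (p.1.1 - e, p.1.2 - e, p.2 - e).
pose u : meas3 R := (p.1.1 + e, p.1.2 + e, p.2 + e).
have boxN : box l u `<=` N.
  move=> q; rewrite /box /= !in_itv /= => -[[/andP[q1l q1u] /andP[q2l q2u]] /andP[q3l q3u]].
  apply: sub => /=; have [Oq gq] : (Omega `&` [set y | g y != 0]) (pt q).
    by apply: eG; rewrite ltr_norml; apply/andP; split; lra.
  by move=> /(_ Oq) gq0; move: gq; rewrite /= => /eqP gq; apply: gq; case: gq0.
have : (mu (box l u) <= 0)%E.
  by rewrite -N0; apply: le_measure; rewrite ?inE//; exact: measurable_box.
have [l1 l2 l3] : [/\ l.1.1 < u.1.1, l.1.2 < u.1.2 & l.2 < u.2].
  by rewrite /=; split; lra.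
have -> : mu (box l u) = _ := volume_box l1 l2 l3.
by rewrite lee_fin leNgt !mulr_gt0// subr_gt0.
Qed.

Lemma ccyl_compact : compact (ccyl Omega T).
Proof.
have -> : ccyl Omega T = closure Omega `*` `[0, T].
  by apply/seteqP; split => -[x t]; rewrite /ccyl /= in_itv.
apply: compact_setX; last exact: segment_compact.
apply: bounded_closed_compact; last exact: closed_closure.
case: bO => M [rM bM]; exists M; split => // M' MM' /= x.
have cM : closed [set x : vec R | `|x| <= M'].
  by apply: closed_comp (@closed_le R M') => y _; exact: norm_continuous.
move=> Ox; suff : closure [set x : vec R | `|x| <= M'] x.
  by rewrite -((closure_id _).1 cM).
by apply: closureS Ox => y; exact: bM.
Qed.

Hypothesis T0 : 0 < T.

(** The integral of [w] over [Omega] is constant in time, as its derivative is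
    the integral of [dt w]. Since [w] vanishes at [t0] and [dt w] is bounded on
    the compact closed cylinder, [w (x, t)] is at most a fixed multiple of
    [|t - t0|]; hence the integral is zero, and so is the nonnegative [w]. Only
    times in the open interval are compared, which is why [t0] may be an
    endpoint. *)
Lemma zero_mean_rate_eq0 (w : stime R -> R) (t0 : R) :
  (forall p, ccyl Omega T p -> smooth1 w p) ->
  (forall x t, Omega x -> 0 <= t <= T -> 0 <= w (x, t)) ->
  (forall t, 0 < t < T ->
    (\int[@volume R]_(p in @pt R @^-1` Omega) (dt w (pt p, t))%:E = 0)%E) ->
  0 <= t0 <= T -> (forall x, Omega x -> w (x, t0) = 0) ->
  forall x t, Omega x -> 0 <= t <= T -> w (x, t) = 0.
Proof.
move=> sw w0 iw0 t0T wt0.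
have OC x t : Omega x -> 0 <= t <= T -> ccyl Omega T (x, t).
  by move=> Ox tT; split => //; exact: subset_closure.
move=> x1 t1 Ox1 t1T.
pose mu := product_measure1 (product_measure1 (@lebesgue_measure R)
  (@lebesgue_measure R)) (@lebesgue_measure R).
pose B : set (meas3 R) := @pt R @^-1` Omega.
have mB : measurable B by exact: measurable_pt_open.
have muB : (mu B < +oo)%E by exact: volume_pt_bounded.
have [M M0 dwM] : exists2 M, 0 <= M & forall p, ccyl Omega T p -> `|dt w p| <= M.
  have cf : {within ccyl Omega T, continuous (fun p => `|dt w p|)}.
    apply: continuous_in_subspaceT => p; rewrite inE => /sw sp.
    apply: continuous_comp; first exact: smooth1_continuousD sp.
    exact: norm_continuous.
  have C0 : ccyl Omega T !=set0 by exists (x1, t1); exact: OC.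
  have [c _ cM] := compact_EVT_max C0 ccyl_compact cf.
  by exists `|dt w c| => // p Cp; apply: cM; rewrite inE.
have dw x t : Omega x -> 0 <= t <= T ->
    is_derive t 1 (fun s : R => w (x, s)) (dt w (x, t)).
  move=> Ox tT; apply: DeriveDef; last exact: derive_slicet.
  by apply: smooth1_derivable; apply: smooth1_slicet; exact/sw/OC.
have lip x t : Omega x -> 0 <= t <= T -> w (x, t) <= M * `|t - t0|.
  move=> Ox tT.
  have seg (a b : R) : a <= b -> 0 <= a <= T -> 0 <= b <= T ->
      `|w (x, b) - w (x, a)| <= M * `|b - a|.
    move=> ab /andP[a0 _] /andP[_ bT].
    have [||s sab ->] := @MVT_segment R (fun s : R => w (x, s))
        (fun s => dt w (x, s)) a b ab.
    - move=> s; rewrite in_itv/= => /andP[sa sb]; apply: dw => //.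
      by apply/andP; split; lra.
    - apply: derivable_within_continuous => s; rewrite in_itv/= => /andP[sa sb].
      have [] // := dw x s Ox _.
      by apply/andP; split; lra.
    rewrite normrM ler_wpM2r//; apply: dwM; apply: OC => //.
    by move: sab; rewrite in_itv/= => /andP[sa sb]; apply/andP; split; lra.
  rewrite (le_trans (ler_norm _))//.
  have [tt0|tt0] := leP t t0.
    by have := seg t t0 tt0 tT t0T; rewrite wt0// sub0r normrN distrC.
  by have := seg t0 t (ltW tt0) t0T tT; rewrite wt0// subr0.
pose e t := \int[mu]_(p in B) w (pt p, t).
have cw x t : Omega x -> 0 <= t <= T -> {for x, continuous (fun y => w (y, t))}.
  by move=> Ox tT; apply: smooth1_continuous; apply: smooth1_slice; exact/sw/OC.
have intw t : 0 <= t <= T -> mu.-integrable B (fun p => (w (pt p, t))%:E).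
  move=> tT; apply: measurable_bounded_integrable => //.
    by apply: (measurable_pt_fun (g := fun x => w (x, t)) oO) => x Ox; exact: cw.
  exists (M * `|t - t0|); split; first exact: num_real.
  move=> M' MM' p /= Bp; rewrite ger0_norm ?w0// (le_trans _ (ltW MM'))//.
  exact: lip.
have intM r : mu.-integrable B (EFin \o cst r).
  apply: measurable_bounded_integrable => //.
  by exists `|r|; split; [exact: num_real|move=> M' /ltW rM' p _ /=].
have de t : 0 < t < T -> is_derive t 1 e 0.
  move=> tT.
  have It : `]0, T[%classic t by rewrite /= in_itv.
  have I_ s : `]0, T[%classic s -> 0 <= s <= T.
    by rewrite /= in_itv/= => /andP[s0 sT]; rewrite !ltW.
  have iw s : `]0, T[%classic s -> mu.-integrable B (EFin \o (fun p => w (pt p, s))).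
    by move=> /I_; exact: intw.
  have dw' s p : `]0, T[%classic s -> B p -> derivable (fun s => w (pt p, s)) s 1.
    by move=> /I_ sT Bp; have [] := dw _ _ Bp sT.
  have dwM' s p : `]0, T[%classic s -> B p ->
      `|partial1of2 (fun s p => w (pt p, s)) s p| <= cst M p.
    move=> /I_ sT Bp; rewrite partial1of2E derive_slicet.
    by apply: dwM; exact: OC.
  have M0' (p : meas3 R) : 0 <= (cst M : meas3 R -> R) p by [].
  apply: DeriveDef.
    exact: (derivable_under_integral mB It iw dw' M0' (intM M) dwM').
  rewrite -derive1E.
  rewrite (differentiation_under_integral mB It iw dw' M0' (intM M) dwM').
  apply: etrans (congr1 fine (iw0 t tT)).
  rewrite /Rintegral; apply: (congr1 fine); apply: eq_integral => p _.
  by rewrite partial1of2E derive_slicet.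
have e_le t : 0 < t < T -> e t <= (M * fine (mu B)) * `|t - t0|.
  move=> tT; rewrite mulrAC -Rintegral_cst//.
  have tT' : 0 <= t <= T by move/andP : tT => [? ?]; rewrite !ltW.
  apply: le_Rintegral => //; first exact: intw.
    exact: intM.
  by move=> p Bp; exact: lip.
have e_cst s t : 0 < s < T -> 0 < t < T -> e s = e t.
  wlog st : s t / s <= t.
    move=> H sT tT; have [st|/ltW ts] := leP s t; first exact: H.
    by apply/esym/H.
  move=> /andP[s0 sT] /andP[t0' tT'].
  have [||r _] := @MVT_segment R e (fun=> 0) s t st.
  - move=> r; rewrite in_itv/= => /andP[rs rt]; apply: de.
    by apply/andP; split; lra.
  - apply: derivable_within_continuous => r; rewrite in_itv/= => /andP[rs rt].
    have [] // := de r _.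
    by apply/andP; split; lra.
  by rewrite mul0r => /eqP; rewrite subr_eq0 => /eqP.
have e_le0 s : 0 < s < T -> e s <= 0.
  move=> sT; rewrite leNgt; apply/negP => es.
  set C := M * fine (mu B) in e_le.
  have C0 : 0 <= C by rewrite mulr_ge0// fine_ge0.
  (* t0 + r or t0 - r is a time at which e_le contradicts es; the bound by
     T / 4 keeps one of the two inside the interval *)
  pose r := Num.min (T / 4) (e s / (C + 1)).
  have r0 : 0 < r by rewrite lt_min !divr_gt0//; lra.
  have rT : r <= T / 4 by rewrite ge_min lexx.
  have re : C * r < e s.
    rewrite (@le_lt_trans _ _ (C * (e s / (C + 1))))//.
      by rewrite ler_wpM2l// ge_min lexx orbT.
    by rewrite mulrCA -[ltRHS]mulr1 ltr_pM2l// ltr_pdivrMr ?mul1r; lra.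
  have [t tT tr] : exists2 t, 0 < t < T & `|t - t0| = r.
    move/andP: t0T => [t00 t0T].
    have [h|h] := leP t0 (T / 2).
      exists (t0 + r); first by apply/andP; split; lra.
      by rewrite addrAC subrr add0r gtr0_norm.
    exists (t0 - r); first by apply/andP; split; lra.
    by rewrite addrAC subrr add0r normrN gtr0_norm.
  by have := e_le t tT; rewrite -(e_cst s t)// tr leNgt re.
have e0 s : 0 < s < T -> forall x, Omega x -> w (x, s) = 0.
  move=> sT.
  have sT' : 0 <= s <= T by move/andP : sT => [? ?]; rewrite !ltW.
  apply: integral_eq0_continuous => [x Ox|x Ox|]; [exact: cw|exact: w0|].
  have es0 : e s = 0.
    apply/eqP; rewrite eq_le e_le0//=; apply: Rintegral_ge0 => p Bp; exact: w0.
  have <- : (e s)%:E = 0%E by rewrite es0.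
  by rewrite /e /Rintegral fineK//; exact: integrable_fin_num (intw s sT').
apply: (cyl_continuous_eq0 (Omega := Omega) T0 (f := w)).
- by move=> p /sw; exact: smooth1_continuous.
- by move=> x s Ox sT; exact: e0.
- exact: OC.
Qed.

End evolution.

(** * Normals and vanishing flux *)

Section dotv.
Context {R : realType}.
Implicit Types a b h : vec R.

Lemma dotvC a b : dotv a b = dotv b a.
Proof. by apply: eq_bigr => j _; rewrite mulrC. Qed.

Lemma dotvDr a b h : dotv a (b + h) = dotv a b + dotv a h.
Proof. by rewrite -big_split; apply: eq_bigr => j _; rewrite mxE mulrDr. Qed.

Lemma dotvZr k a b : dotv a (k *: b) = k * dotv a b.
Proof. by rewrite mulr_sumr; apply: eq_bigr => j _; rewrite mxE mulrCA. Qed.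

Lemma dotvZl k a b : dotv (k *: a) b = k * dotv a b.
Proof. by rewrite dotvC dotvZr dotvC. Qed.

Lemma dotv_ge0 a : 0 <= dotv a a.
Proof. by apply: sumr_ge0 => j _; rewrite -expr2 sqr_ge0. Qed.

Lemma dotv_eq0 a : (dotv a a == 0) = (a == 0).
Proof.
apply/eqP/eqP => [a0|->]; last by apply: big1 => j _; rewrite mxE mul0r.
have sq j : true -> 0 <= a 0 j * a 0 j by rewrite -expr2 sqr_ge0.
apply/rowP => j; rewrite mxE; apply/eqP; rewrite -sqrf_eq0 expr2; apply/eqP.
exact: psumr_eq0P sq a0 j isT.
Qed.

(** Otherwise [a] has a nonzero component [c] orthogonal to [b], and
    [h = m c - b] with [m] large satisfies [b.h < 0 < a.h]. *)
Lemma dotv_parallel a b : b != 0 ->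
  (forall h, dotv b h < 0 -> dotv a h <= 0) -> exists k, a = k *: b.
Proof.
move=> b0 ab.
have bb : 0 < dotv b b by rewrite lt_def dotv_eq0 b0 dotv_ge0.
pose k := dotv a b / dotv b b; exists k.
pose c := a - k *: b.
have cb : dotv b c = 0.
  rewrite /c dotvDr -scaleNr dotvZr (dotvC b a) /k mulNr divfK ?subrr//.
  by rewrite gt_eqF.
have ac : dotv a c = dotv c c.
  have aE : a = k *: b + c by rewrite addrC subrK.
  by rewrite [X in dotv X c]aE dotvC dotvDr dotvZr (dotvC c b) cb mulr0 add0r.
apply/eqP; rewrite -subr_eq0 -/c -dotv_eq0 eq_le dotv_ge0 andbT leNgt.
apply/negP => cc.
pose m := (`|k * dotv b b| + 1) / dotv c c.
have := ab (m *: c - b).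
rewrite -scaleN1r !dotvDr !dotvZr cb mulr0 add0r mulN1r ac oppr_lt0 => /(_ bb).
rewrite /m divfK ?gt_eqF// leNgt; apply/negP; rewrite negbK.
have -> : dotv a b = k * dotv b b by rewrite /k divfK// gt_eqF.
by rewrite mulN1r subr_gt0 (le_lt_trans (ler_norm _))// ltrDl.
Qed.

Lemma dotv_unit_neq0 a : dotv a a = 1 -> a != 0.
Proof. by rewrite -dotv_eq0 => ->; exact: oner_neq0. Qed.

End dotv.

Lemma continuous_sum (R : realType) (W : topologicalType) (I : Type) (r : seq I)
    (f : I -> W -> R) p : (forall i, {for p, continuous (f i)}) ->
  {for p, continuous (fun q => \sum_(i <- r) f i q)}.
Proof.
move=> cf; elim: r => [|i r IH].
  have -> : (fun q => \sum_(i <- [::]) f i q) = fun=> 0.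
    by apply/funext => q; rewrite big_nil.
  exact: cst_continuous.
have -> : (fun q => \sum_(j <- i :: r) f j q) =
    (fun q => f i q + \sum_(j <- r) f j q).
  by apply/funext => q; rewrite big_cons.
by apply: cvgD; [exact: cf|exact: IH].
Qed.

Section normal.
Context {R : realType}.
Variable Omega : set (vec R).
Hypothesis oO : open Omega.

Lemma derive_sgrad (phi : vec R -> R) y h :
  differentiable phi y -> 'D_h phi y = dotv (sgrad phi y) h.
Proof.
move=> dphi; rewrite deriveE// {1}(row_sum_delta h) linear_sum.
by apply: eq_bigr => j _; rewrite linearZ /= mxE deriveE// mulrC.
Qed.

Lemma boundary_notin y : boundary Omega y -> ~ Omega y.
Proof.
move=> [_ cl] Oy; have [z [nOz Oz]] := cl _ (open_nbhs_nbhs (conj oO Oy)).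
exact: nOz.
Qed.

Lemma defining_eq0 (phi : vec R -> R) (U : set (vec R)) y : open U -> U y ->
  (forall z, U z -> (Omega z <-> phi z < 0)) -> {for y, continuous phi} ->
  boundary Omega y -> phi y = 0.
Proof.
move=> oU Uy Uphi cphi by_; apply/eqP; rewrite eq_le; apply/andP; split; last first.
  by rewrite leNgt; apply/negP => /(Uphi _ Uy); exact: boundary_notin.
rewrite leNgt; apply/negP => phiy.
have [cl _] := by_.
have /(_ [set z | 0 < z]) fc := cphi.
have [|z [Oz [Uz phiz]]] := cl (U `&` phi @^-1` [set z | 0 < z]).
  apply: filterI; first exact: open_nbhs_nbhs.
  by apply: fc; apply: open_nbhs_nbhs; split => //; exact: open_gt.
by have := (Uphi z Uz).1 Oz; rewrite ltNge ltW.
Qed.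

Lemma derive_gt0_near (f : vec R -> R) y h : differentiable f y ->
  f y = 0 -> 0 < 'D_h f y -> \forall t \near (0 : R)^'+, 0 < f (t *: h + y).
Proof.
move=> df fy dfy.
have qc : (fun t : R => t^-1 *: (f (t *: h + y) - f y)) @ 0^'+ --> 'D_h f y.
  apply: cvg_dnbhs_at_right.
  exact: (diff_derivable df).
have q0 : \forall t \near (0 : R)^'+, 0 < t^-1 *: (f (t *: h + y) - f y).
  exact: (cvgr_gt _ qc).
near=> t; have t0 : 0 < t by [].
have : 0 < t^-1 *: (f (t *: h + y) - f y) by near: t.
by rewrite fy subr0 /= -[_ *: _]/(_ * _) pmulr_rgt0// invr_gt0.
Unshelve. all: by end_near. Qed.

(** Directions that decrease [psi] enter [Omega], so they cannot increase [phi];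
    by [dotv_parallel] the gradients are parallel. Hence the normal does not
    depend on the function that defines the boundary. *)
Lemma defining_parallel (phi psi : vec R -> R) (U V : set (vec R)) y :
  open U -> U y -> (forall z, U z -> (Omega z <-> phi z < 0)) ->
  differentiable phi y ->
  open V -> V y -> (forall z, V z -> (Omega z <-> psi z < 0)) ->
  differentiable psi y -> sgrad psi y != 0 ->
  boundary Omega y -> exists k, sgrad phi y = k *: sgrad psi y.
Proof.
move=> oU Uy Uphi dphi oV Vy Vpsi dpsi gpsi by_.
have phiy := defining_eq0 oU Uy Uphi (differentiable_continuous dphi) by_.
have psiy := defining_eq0 oV Vy Vpsi (differentiable_continuous dpsi) by_.
apply: dotv_parallel => // h; rewrite -!derive_sgrad// => dh.
rewrite leNgt; apply/negP => dh'.
have dNpsi : differentiable (fun z => - psi z) y by exact: differentiableN.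
have nphi := derive_gt0_near dphi phiy dh'.
have npsi : \forall t \near (0 : R)^'+, 0 < - psi (t *: h + y).
  apply: (derive_gt0_near (f := fun z => - psi z)) => //.
    by rewrite psiy oppr0.
  have -> : 'D_h (fun z => - psi z) y = - 'D_h psi y.
    by apply: deriveN; exact: diff_derivable.
  by rewrite oppr_gt0.
have nUV : \forall t \near (0 : R)^'+, (U `&` V) (t *: h + y).
  have c : (fun t : R => t *: h + y) @ 0^'+ --> y.
    rewrite -[X in _ --> X]add0r -(scale0r h); apply: cvg_at_right_filter.
    by apply: cvgD; [apply: cvgZ; [exact: cvg_id|exact: cvg_cst]|exact: cvg_cst].
  exact: c _ (filterI (open_nbhs_nbhs (conj oU Uy)) (open_nbhs_nbhs (conj oV Vy))).
have [t [[pt1 pt2] [pt3 pt4]]] := filter_ex (filterI (filterI nphi npsi) nUV).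
have psi0 : psi (t *: h + y) < 0 by rewrite -oppr_gt0.
have := (Uphi _ pt3).1 ((Vpsi _ pt4).2 psi0).
by move: pt1 => /= pt1; rewrite ltNge ltW.
Qed.

(** The two parts [Gs] and [Gu] only need to be dense in the boundary. At a limit
    of points of [Gu] the field [v] vanishes by continuity. Near [x] the boundary
    is a level set of some [phi] with nonzero gradient; all boundary points there
    are regular with normal parallel to the gradient of [phi], so at a limit of
    points of [Gs] the continuous field [s (grad phi)] vanishes. *)
Lemma flux_eq0 (Gs Gu : set (vec R)) (n : vec R -> vec R)
    (v : 'I_3 -> vec R -> R) (s : 'I_3 -> 'I_3 -> vec R -> R) x :
  is_normal_field Omega n -> boundary Omega = closure (Gs `|` Gu) ->
  (forall i, {for x, continuous (v i)}) ->
  (forall i j, {for x, continuous (s i j)}) ->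
  (forall y, Gu y -> forall i, v i y = 0) ->
  (forall y, Gs y -> regular_boundary Omega y ->
     forall i, \sum_j s i j y * n y 0 j = 0) ->
  regular_boundary Omega x ->
  \sum_j (\sum_i v i x * s i j x) * n x 0 j = 0.
Proof.
move=> nn hG cv cs vGu sGs rx.
have [bx nx1 [phi [U [oU Ux [dphi cphi] Uphi [c c0 gc]]]]] := nn x rx.
rewrite (eq_bigr (fun j => \sum_i v i x * (s i j x * n x 0 j))); last first.
  by move=> j _; rewrite mulr_suml; apply: eq_bigr => i _; rewrite mulrA.
rewrite exchange_big big1// => i _ /=; rewrite -mulr_sumr.
have : closure (Gs `|` Gu) x by rewrite -hG.
rewrite closureU => -[clGs|clGu]; last first.
  by rewrite (continuous_eq0_closure (cv i) _ clGu) ?mul0r// => y /vGu.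
have cg j : {for x, continuous (fun y => sgrad phi y 0 j)}.
  have -> : (fun y => sgrad phi y 0 j) = 'D_(delta_mx 0 j : vec R) phi.
    by apply/funext => y; rewrite mxE.
  exact: cphi.
have gx0 : sgrad phi x != 0.
  by rewrite gc scaler_eq0 gt_eqF//= dotv_unit_neq0.
have [j0 gj0] : exists j, sgrad phi x 0 j != 0.
  apply/existsP; apply: contraT; rewrite negb_exists => /forallP g0.
  move/eqP : gx0; case; apply/rowP => j; rewrite [RHS]mxE.
  by apply/eqP; have := g0 j; rewrite negbK.
pose N := U `&` [set y | sgrad phi y 0 j0 != 0].
have nN : nbhs x N.
  apply: filterI; first exact: open_nbhs_nbhs.
  have /(_ [set z | z != 0]) := cg j0; apply.
  by apply: open_nbhs_nbhs; split => //; exact: open_neq.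
suff sphi : \sum_j s i j x * sgrad phi x 0 j = 0.
  move: sphi; rewrite gc.
  rewrite (eq_bigr (fun j => c * (s i j x * n x 0 j))); last first.
    by move=> j _; rewrite mxE mulrCA.
  by rewrite -mulr_sumr => /eqP; rewrite mulf_eq0 gt_eqF//= => /eqP ->; rewrite mulr0.
apply: (continuous_eq0_closure (A := Gs `&` N) (f := fun y => \sum_j s i j y * sgrad phi y 0 j)).
- by apply: continuous_sum => j; exact: (cvgM (cs i j) (cg j)).
- move=> y [Gy [Uy gy]].
  have by_ : boundary Omega y by rewrite hG; apply: subset_closure; left.
  have gy0 : sgrad phi y != 0.
    by apply: contra gy => /eqP ->; rewrite mxE.
  have sq : 0 < Num.sqrt (dotv (sgrad phi y) (sgrad phi y)).
    by rewrite sqrtr_gt0 lt_def dotv_eq0 gy0 dotv_ge0.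
  have ry : regular_boundary Omega y.
    exists ((Num.sqrt (dotv (sgrad phi y) (sgrad phi y)))^-1 *: sgrad phi y).
    split=> //.
      rewrite dotvZl dotvZr mulrA -expr2 exprVn sqr_sqrtr ?dotv_ge0//.
      by rewrite mulVf// dotv_eq0.
    exists phi, U; split => //.
    exists (Num.sqrt (dotv (sgrad phi y) (sgrad phi y))) => //.
    by rewrite scalerA divff ?scale1r// gt_eqF.
  have [_ ny1 [psi [V [oV Vy [dpsi cpsi] Vpsi [k k0 gk]]]]] := nn y ry.
  have [|m gm] := defining_parallel oU Uy Uphi (dphi y Uy) oV Vy Vpsi (dpsi y Vy) _ by_.
    by rewrite gk scaler_eq0 gt_eqF//= dotv_unit_neq0.
  rewrite gm gk scalerA (eq_bigr (fun j => (m * k) * (s i j y * n y 0 j))); last first.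
    by move=> j _; rewrite mxE mulrCA.
  by rewrite -mulr_sumr sGs// mulr0.
- move=> B nB; have [z [Gz [Bz Nz]]] := clGs _ (filterI nB nN).
  by exists z.
Qed.

End normal.

(** * Conservation of energy *)

(** Uniqueness for linear elastodynamics, for a velocity [v] and a strain [e]
    that need not come from a displacement: inside [Omega] they are related only
    by the momentum balance and by the equality [compat] of the stress power. The initial time [t0] is
    arbitrary, so that the problem can be solved forward from [0] and backward
    from [T]. *)
Section energy.
Context {R : realType}.
Variables (Omega Gs Gu : set (vec R)) (n : vec R -> vec R) (T : R).
Hypotheses (hOmega : regular_domain Omega n)
  (hG : boundary Omega = closure (Gs `|` Gu)) (T0 : 0 < T).
Variables (dens : vec R -> R) (C : vec R -> tensor4 R).
Hypotheses (sdens : forall x, closure Omega x -> smooth1 dens x)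
  (sC : forall x i j k l, closure Omega x -> smooth1 (fun y => C y i j k l : R) x)
  (dens0 : forall x, closure Omega x -> 0 < dens x)
  (Cmajor : forall x, closure Omega x -> major_sym (C x))
  (Cpos : forall x, closure Omega x -> posdef_sym (C x)).
Variables (v : 'I_3 -> stime R -> R) (e : 'I_3 -> 'I_3 -> stime R -> R).
Hypotheses (sv : forall i p, ccyl Omega T p -> smooth1 (v i) p)
  (se : forall i j p, ccyl Omega T p -> smooth1 (e i j) p)
  (esym : forall i j p, ccyl Omega T p -> e i j p = e j i p).

Let s i j (p : stime R) : R := \sum_k \sum_l C p.1 i j k l * e k l p.

Hypotheses
  (momentum : forall x t i, Omega x -> 0 < t < T ->
     dens x * dt (v i) (x, t) = \sum_j 'D_(dirx R j) (s i j) (x, t))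
  (compat : forall x t, Omega x -> 0 < t < T ->
     \sum_i \sum_j s i j (x, t) * dt (e i j) (x, t) =
     \sum_i \sum_j s i j (x, t) * 'D_(dirx R j) (v i) (x, t))
  (vGu : forall x t i, Gu x -> 0 < t < T -> v i (x, t) = 0)
  (sGs : forall x t i, Gs x -> regular_boundary Omega x -> 0 < t < T ->
     \sum_j s i j (x, t) * n x 0 j = 0).

Let OC x t : Omega x -> 0 <= t <= T -> ccyl Omega T (x, t).
Proof. by move=> Ox tT; split => //; exact: subset_closure. Qed.

Let ss i j p : ccyl Omega T p -> smooth1 (s i j) p.
Proof.
move=> Cp; apply: smooth1_sum => k; apply: smooth1_sum => l.
apply: smooth1M; last exact: se.
by apply: (@smooth1_space _ _ (fun y => C y i j k l : R)); apply: sC; case: Cp.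
Qed.

Let energy (p : stime R) : R :=
  dens p.1 * (\sum_i v i p * v i p) + \sum_i \sum_j s i j p * e i j p.

Let senergy p : ccyl Omega T p -> smooth1 energy p.
Proof.
move=> Cp; apply: smooth1D.
  apply: smooth1M.
    by apply: (@smooth1_space _ _ dens); apply: sdens; case: Cp.
  by apply: smooth1_sum => i; apply: smooth1M; exact: sv.
apply: smooth1_sum => i; apply: smooth1_sum => j.
by apply: smooth1M; [exact: ss|exact: se].
Qed.

Let ddot_se p : \sum_i \sum_j s i j p * e i j p =
  ddot (\matrix_(i, j) e i j p) (app4 (C p.1) (\matrix_(i, j) e i j p)).
Proof.
apply: eq_bigr => i _; apply: eq_bigr => j _; rewrite !mxE mulrC; congr (_ * _).
by apply: eq_bigr => k _; apply: eq_bigr => l _; rewrite mxE.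
Qed.

Let symt_e p : ccyl Omega T p -> symt (\matrix_(i, j) e i j p).
Proof. by move=> Cp; apply/matrixP => i j; rewrite !mxE esym. Qed.

Let strain_ge0 p : ccyl Omega T p -> 0 <= \sum_i \sum_j s i j p * e i j p.
Proof.
move=> Cp; rewrite ddot_se; set E := \matrix_(i, j) _.
have [->|E0] := eqVneq E 0.
  by rewrite /ddot big1// => i _; rewrite big1// => j _; rewrite mxE mul0r.
by apply/ltW/Cpos => //; [case: Cp|exact: symt_e].
Qed.

Let kinetic_ge0 p : ccyl Omega T p -> 0 <= dens p.1 * (\sum_i v i p * v i p).
Proof.
move=> Cp; apply: mulr_ge0; first by apply/ltW/dens0; case: Cp.
by apply: sumr_ge0 => i _; rewrite -expr2 sqr_ge0.
Qed.

Let energy_eq0 p : ccyl Omega T p -> energy p = 0 ->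
  (forall i, v i p = 0) /\ (forall i j, e i j p = 0).
Proof.
move=> Cp /eqP; rewrite /energy paddr_eq0 ?kinetic_ge0 ?strain_ge0//.
move=> /andP[/eqP k0 /eqP se0]; have clp : closure Omega p.1 by case: Cp.
split=> [i|i j].
  move/eqP : k0; rewrite mulf_eq0 gt_eqF ?dens0//= => /eqP k0.
  apply/eqP; rewrite -sqrf_eq0 expr2; apply/eqP.
  by apply: (psumr_eq0P _ k0) => // k _; rewrite -expr2 sqr_ge0.
move: se0; rewrite ddot_se => se0.
have /matrixP/(_ i j) : \matrix_(i, j) e i j p = 0.
  apply/eqP; apply: contraT => E0.
  by have := Cpos clp (symt_e Cp) E0; rewrite se0 ltxx.
by rewrite !mxE.
Qed.

Let dt_s i j p : ccyl Omega T p ->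
  dt (s i j) p = \sum_k \sum_l C p.1 i j k l * dt (e k l) p.
Proof.
move=> Cp; have sCp k l : smooth1 (fun q : stime R => C q.1 i j k l : R) p.
  by apply: (@smooth1_space _ _ (fun y => C y i j k l : R)); apply: sC; case: Cp.
rewrite /dt derive_smooth_sum => [|k]; last first.
  by apply: smooth1_sum => l; apply: smooth1M; [exact: sCp|exact: se].
apply: eq_bigr => k _; rewrite derive_smooth_sum => [|l]; last first.
  by apply: smooth1M; [exact: sCp|exact: se].
apply: eq_bigr => l _; rewrite derive_smoothM//; last exact: se.
have d0 : 'D_(dirt R) (fun q : stime R => C q.1 i j k l : R) p = 0 :=
  @derive_space_dirt _ _ (fun y => C y i j k l : R) p.
by rewrite d0 mulr0 addr0.
Qed.

(** Major symmetry makes the stress power half the rate of the strain energy. *)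
Let dt_strain p : ccyl Omega T p ->
  \sum_i \sum_j e i j p * dt (s i j) p = \sum_i \sum_j s i j p * dt (e i j) p.
Proof.
move=> Cp; have Csym i j k l : C p.1 i j k l = C p.1 k l i j.
  have clp : closure Omega p.1 by case: Cp.
  by rewrite {1}(Cmajor clp).
pose G i j k l := C p.1 i j k l * e i j p * dt (e k l) p.
transitivity (\sum_i \sum_j \sum_k \sum_l G i j k l).
  apply: eq_bigr => i _; apply: eq_bigr => j _; rewrite dt_s// mulr_sumr.
  apply: eq_bigr => k _; rewrite mulr_sumr; apply: eq_bigr => l _.
  by rewrite /G mulrA (mulrC (e i j p)).
transitivity (\sum_k \sum_l \sum_i \sum_j G i j k l).
  rewrite (eq_bigr (fun i => \sum_k \sum_l \sum_j G i j k l)); last first.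
    move=> i _; rewrite exchange_big; apply: eq_bigr => k _.
    by rewrite exchange_big.
  rewrite exchange_big; apply: eq_bigr => k _.
  by rewrite exchange_big.
apply: eq_bigr => k _; apply: eq_bigr => l _.
rewrite /s mulr_suml; apply: eq_bigr => i _; rewrite mulr_suml.
by apply: eq_bigr => j _; rewrite /G Csym.
Qed.

Let dt_energy p : ccyl Omega T p -> dt energy p =
  2 * (dens p.1 * (\sum_i v i p * dt (v i) p) + \sum_i \sum_j s i j p * dt (e i j) p).
Proof.
move=> Cp.
have sd : smooth1 (fun q : stime R => dens q.1) p.
  by apply: (@smooth1_space _ _ dens); apply: sdens; case: Cp.
have svv i : smooth1 (fun q => v i q * v i q) p by apply: smooth1M; exact: sv.
have sse i j : smooth1 (fun q => s i j q * e i j q) p.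
  by apply: smooth1M; [exact: ss|exact: se].
have sk : smooth1 (fun q => \sum_i v i q * v i q) p := smooth1_sum _ svv.
have ske i : smooth1 (fun q => \sum_j s i j q * e i j q) p := smooth1_sum _ (sse i).
rewrite /dt /energy (derive_smoothD _ (smooth1M sd sk) (smooth1_sum _ ske)).
have d0 : 'D_(dirt R) (fun q : stime R => dens q.1) p = 0 := derive_space_dirt dens p.
rewrite (derive_smoothM _ sd sk) d0 mulr0 addr0.
rewrite (derive_smooth_sum _ _ svv) (derive_smooth_sum _ _ ske).
rewrite mulrDr; congr (_ + _).
  rewrite mulrCA; congr (_ * _); rewrite mulr_sumr; apply: eq_bigr => i _.
  by rewrite (derive_smoothM _ (sv i Cp) (sv i Cp)); ring.
rewrite mulr_natl mulr2n -{1}(dt_strain Cp) -big_split /=; apply: eq_bigr => i _.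
rewrite (derive_smooth_sum _ _ (sse i)) -big_split /=; apply: eq_bigr => j _.
by rewrite (derive_smoothM _ (ss i j Cp) (se i j Cp)) addrC.
Qed.

(** The power of the stress across a surface element; the factor 2 comes from
    the missing halves in [energy]. *)
Let F t (x : vec R) : vec R := \row_j (2 * \sum_i v i (x, t) * s i j (x, t)).

Let sF t x : 0 < t < T -> closure Omega x -> smooth1 (F t) x.
Proof.
move=> /andP[t0 tT] clx; apply: smooth1_mx => z j.
have -> : (fun y => F t y z j) = (fun y => 2 * \sum_i v i (y, t) * s i j (y, t)).
  by apply/funext => y; rewrite mxE.
have Cp : ccyl Omega T (x, t) by split => //=; rewrite !ltW.
apply: smooth1M; first exact: smooth1_cst.
apply: smooth1_sum => i; apply: smooth1M.
  by apply: smooth1_slice; exact: sv.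
by apply: smooth1_slice; exact: ss.
Qed.

Let sdiv_F t x : 0 < t < T -> Omega x -> sdiv (F t) x = dt energy (x, t).
Proof.
move=> tT Ox; have /andP[t0 tT'] := tT.
have Cp : ccyl Omega T (x, t) by apply: OC => //; rewrite !ltW.
have Fj j : (fun y => F t y 0 j) = (fun y => 2 * \sum_i v i (y, t) * s i j (y, t)).
  by apply/funext => y; rewrite mxE.
have dFj j : ('D_(delta_mx 0 j : vec R) (F t) x) 0 j =
    2 * \sum_i (v i (x, t) * 'D_(dirx R j) (s i j) (x, t)
                + s i j (x, t) * 'D_(dirx R j) (v i) (x, t)).
  rewrite -derive_coord; last by apply: smooth1_derivable; apply: sF => //; case: Cp.
  have svs i : smooth1 (fun q => v i q * s i j q) (x, t).
    exact: (smooth1M (sv i Cp) (ss i j Cp)).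
  rewrite Fj (derive_slice (fun q => 2 * \sum_i v i q * s i j q)).
  rewrite derive_smoothM; [|exact: smooth1_cst|]; last first.
    exact: (smooth1_sum _ svs).
  rewrite derive_cst mulr0 addr0; congr (_ * _).
  rewrite (derive_smooth_sum _ _ svs).
  by apply: eq_bigr => i _; rewrite (derive_smoothM _ (sv i Cp) (ss i j Cp)).
rewrite dt_energy//= /sdiv (eq_bigr _ (fun j _ => dFj j)) -mulr_sumr.
congr (2 * _); rewrite exchange_big compat//= mulr_sumr -big_split /=.
apply: eq_bigr => i _; rewrite big_split /=; congr (_ + _).
by rewrite mulrCA momentum// mulr_sumr.
Qed.

(** The divergence theorem turns the rate of the total energy into a boundary
    integral, which vanishes by [flux_eq0]. *)
Lemma energy_uniqueness t0 : 0 <= t0 <= T ->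
  (forall x i, Omega x -> v i (x, t0) = 0) ->
  (forall x i j, Omega x -> e i j (x, t0) = 0) ->
  forall x t, Omega x -> 0 <= t <= T ->
    (forall i, v i (x, t) = 0) /\ (forall i j, e i j (x, t) = 0).
Proof.
move=> t0T v0 e0 x t Ox tT.
have [oO _ _ bO [nn [sigma [_ divT_]]]] := hOmega.
apply: energy_eq0; first exact: OC.
apply: (zero_mean_rate_eq0 oO bO T0 senergy _ _ t0T) => //.
- move=> y r Oy rT; have Cp := OC Oy rT.
  by apply: addr_ge0; [exact: kinetic_ge0|exact: strain_ge0].
- move=> r rT.
  have FC1 : C1_near (closure Omega) (F r) by apply: smooth1_C1_near => y; exact: sF.
  transitivity (\int[@volume R]_(p in @pt R @^-1` Omega) (sdiv (F r) (pt p))%:E)%E.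
    by apply: eq_integral => p; rewrite inE => Op; rewrite sdiv_F.
  rewrite divT_// integral0_eq// => p rp.
  have /andP[r0 rT'] := rT.
  have Cp : ccyl Omega T (pt p, r).
    by have [nu [[cl _] _ _]] := rp; split => //=; rewrite !ltW.
  congr (_%:E); rewrite /dotv.
  transitivity (2 * \sum_j (\sum_i v i (pt p, r) * s i j (pt p, r)) * n (pt p) 0 j).
    by rewrite mulr_sumr; apply: eq_bigr => j _; rewrite mxE mulrA.
  rewrite (flux_eq0 (v := fun i y => v i (y, r)) (s := fun i j y => s i j (y, r))
    oO nn hG) ?mulr0//.
  + by move=> i; apply: smooth1_continuous; apply: smooth1_slice; exact: sv.
  + by move=> i j; apply: smooth1_continuous; apply: smooth1_slice; exact: ss.
  + by move=> y Gy i; exact: vGu.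
  + by move=> y Gy ry i; exact: sGs.
- move=> y Oy; rewrite /energy big1 ?mulr0 ?add0r; last by move=> i _; rewrite v0// mul0r.
  by rewrite big1// => i _; rewrite big1// => j _; rewrite e0// mulr0.
Qed.

End energy.

(** * Smoothness of the fields *)

Section smooth_fields.
Context {R : realType}.

Lemma smooth1_app4 (W : normedModType R) (A : W -> tensor4 R)
    (e : W -> tensor2 R) p :
  (forall i j k l, smooth1 (fun q => A q i j k l : R) p) -> smooth1 e p ->
  smooth1 (fun q => app4 (A q) (e q)) p.
Proof.
move=> sA se; apply: smooth1_mx => i j.
have -> : (fun q => app4 (A q) (e q) i j) =
    (fun q => \sum_k \sum_l A q i j k l * e q k l).
  by apply/funext => q; rewrite mxE.
apply: smooth1_sum => k; apply: smooth1_sum => l.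
exact: (smooth1M (sA i j k l) (smooth1_coord k l se)).
Qed.

Lemma smooth1_scale (W : normedModType R) m n (k : W -> R)
    (f : W -> 'M[R]_(m.+1, n.+1)) p :
  smooth1 k p -> smooth1 f p -> smooth1 (fun q => k q *: f q) p.
Proof.
move=> sk sf; apply: smooth1_mx => i j.
have -> : (fun q => (k q *: f q) i j) = (fun q => k q * f q i j).
  by apply/funext => q; rewrite mxE.
exact: (smooth1M sk (smooth1_coord i j sf)).
Qed.

Lemma smooth1_sympart (W : normedModType R) (e : W -> tensor2 R) p :
  smooth1 e p -> smooth1 (fun q => sympart (e q)) p.
Proof.
move=> se; apply: smooth1_mx => i j.
have -> : (fun q => sympart (e q) i j) = (fun q => 2^-1 * (e q i j + e q j i)).
  by apply/funext => q; rewrite !mxE.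
exact: (smooth1M (smooth1_cst _ p)
  (smooth1D (smooth1_coord i j se) (smooth1_coord j i se))).
Qed.

Lemma smooth1_grad (f : stime R -> vec R) p :
  (forall w, smooth1 ('D_w f) p) -> smooth1 (grad f) p.
Proof.
move=> sf; apply: smooth1_mx => i j.
have -> : (fun q => grad f q i j) = (fun q => ('D_(dirx R j) f q) 0 i).
  by apply/funext => q; rewrite mxE.
exact: (smooth1_coord 0 i (sf (dirx R j))).
Qed.

Lemma smooth1_divT (f : stime R -> tensor2 R) p :
  (forall w, smooth1 ('D_w f) p) -> smooth1 (divT f) p.
Proof.
move=> sf; apply: smooth1_mx => i j.
have -> : (fun q => divT f q i j) = (fun q => \sum_k ('D_(dirx R k) f q) j k).
  by apply/funext => q; rewrite mxE.
apply: smooth1_sum => k; exact: (smooth1_coord j k (sf (dirx R k))).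
Qed.

Definition smooth_dual (f : dual R) (p : stime R) : Prop :=
  [/\ smooth1 (gam f) p, smooth1 (lam f) p, smooth1 (mu f) p &
   forall w, [/\ smooth1 ('D_w (gam f)) p, smooth1 ('D_w (lam f)) p &
              smooth1 ('D_w (mu f)) p]].

Lemma dual_smooth_at (Omega : set (vec R)) T f p :
  dual_smooth Omega T f -> ccyl Omega T p -> smooth_dual f p.
Proof.
move=> [g l m] Cp; split.
- exact: C2_near_smooth1 g Cp.
- exact: C2_near_smooth1 l Cp.
- exact: C2_near_smooth1 m Cp.
- move=> w; split.
  + exact: C2_near_smooth1D g Cp.
  + exact: C2_near_smooth1D l Cp.
  + exact: C2_near_smooth1D m Cp.
Qed.

(** The derivative of a difference is the difference of the derivatives only
    where both exist, that is near [p]. *)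
Lemma smooth1_sub2 (W X : normedModType R) (f g : W -> X) p w :
  smooth1 f p -> smooth1 g p -> smooth1 ('D_w f) p -> smooth1 ('D_w g) p ->
  smooth1 ('D_w (fun q => f q - g q)) p.
Proof.
move=> sf sg sf' sg'; apply: (near_smooth1 (f := fun q => 'D_w f q - 'D_w g q)).
  apply: filterS2 (smooth1_near sf) (smooth1_near sg) => q sfq sgq.
  exact/esym/derive_smoothB.
exact: smooth1B sf' sg'.
Qed.

Lemma smooth_dual_sub f g p : smooth_dual f p -> smooth_dual g p ->
  smooth_dual (dual_sub f g) p.
Proof.
move=> [fg fl fm f2] [gg gl gm g2]; split.
- exact: smooth1B fg gg.
- exact: smooth1B fl gl.
- exact: smooth1B fm gm.
move=> w; have [fg' fl' fm'] := f2 w; have [gg' gl' gm'] := g2 w; split.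
- exact: smooth1_sub2 fg gg fg' gg'.
- exact: smooth1_sub2 fl gl fl' gl'.
- exact: smooth1_sub2 fm gm fm' gm'.
Qed.

Lemma smooth1_Ldu f p : smooth_dual f p -> smooth1 (Ldu f) p.
Proof.
move=> [_ _ _ f2]; have [g2 _ _] := f2 (dirt R).
apply: smooth1D; first exact: g2.
by apply: smooth1_divT => w; have [] := f2 w.
Qed.

Variables (Omega : set (vec R)) (T : R) (c : coefficients R).
Hypotheses (hc : admissible_coefficients Omega T c)
  (hcs : smooth_coefficients Omega T c).

Lemma smooth1_rho p : ccyl Omega T p -> smooth1 (fun q : stime R => rho c q.1) p.
Proof.
move=> [clp _]; have [_ h _ _ _] := hcs.
exact: (smooth1_space (C2_near_smooth1 h clp)).
Qed.

Lemma smooth1_rrV p : ccyl Omega T p -> smooth1 (fun q : stime R => (rr c q.1)^-1) p.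
Proof.
move=> [clp _]; have [_ _ h _ _] := hcs; have [_ r0 _] := hc.
apply: smooth1V; first by rewrite gt_eqF// r0.
exact: (smooth1_space (C2_near_smooth1 h clp)).
Qed.

Lemma smooth1_Cm i j k l x : closure Omega x -> smooth1 (fun y => Cm c y i j k l : R) x.
Proof. by move=> clx; have [h _ _ _ _] := hcs; exact: C2_near_smooth1 (h i j k l) clx. Qed.

Lemma smooth1_Cmt i j k l p : ccyl Omega T p ->
  smooth1 (fun q : stime R => Cm c q.1 i j k l : R) p.
Proof.
move=> [clp _]; apply: (@smooth1_space _ _ (fun y => Cm c y i j k l : R)).
exact: smooth1_Cm.
Qed.

Lemma smooth1_Ainv i j k l p : ccyl Omega T p ->
  smooth1 (fun q => Ainv c q i j k l : R) p.
Proof. by move=> Cp; have [_ _ _ _ h] := hcs; exact: C2_near_smooth1 (h i j k l) Cp. Qed.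

Lemma smooth1_Ldv f p : ccyl Omega T p -> smooth_dual f p -> smooth1 (Ldv c f) p.
Proof.
move=> Cp [fg _ _ f2]; have [_ l2 _] := f2 (dirt R).
exact: (smooth1D fg (smooth1_scale (smooth1_rho Cp) l2)).
Qed.

Lemma smooth1_LdE f p : ccyl Omega T p -> smooth_dual f p -> smooth1 (LdE c f) p.
Proof.
move=> Cp [_ _ fm f2]; apply: smooth1B; first exact: smooth1_sympart fm.
apply: (@smooth1_app4 _ (fun q : stime R => tr4 (Cm c q.1))) => [i j k l|].
  exact: smooth1_Cmt.
by apply: smooth1_grad => w; have [] := f2 w.
Qed.

Lemma smooth1_vLdv f p : ccyl Omega T p -> smooth_dual f p ->
  smooth1 (fun q => (rr c q.1)^-1 *: Ldv c f q) p.
Proof. by move=> Cp sf; exact: smooth1_scale (smooth1_rrV Cp) (smooth1_Ldv Cp sf). Qed.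

Lemma smooth1_ELdE f p : ccyl Omega T p -> smooth_dual f p ->
  smooth1 (fun q => app4 (Ainv c q) (LdE c f q)) p.
Proof.
move=> Cp sf; apply: smooth1_app4 => [i j k l|]; first exact: smooth1_Ainv.
exact: smooth1_LdE Cp sf.
Qed.

End smooth_fields.

(** * The homogeneous problem *)

Section cylinder.
Context {R : realType}.
Variables (Omega : set (vec R)) (T : R).
Implicit Types (f : stime R -> R).

Lemma near_cyl x t : open Omega -> Omega x -> 0 < t < T ->
  \forall q \near ((x, t) : stime R), Omega q.1 /\ 0 < q.2 < T.
Proof.
move=> oO Ox tT; exists (Omega, [set s | 0 < s < T]) => /=.
  split; first exact: open_nbhs_nbhs (conj oO Ox).
  have -> : [set s | 0 < s < T] = `]0, T[%classic.
    by apply/seteqP; split => s; rewrite /= in_itv.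
  apply: open_nbhs_nbhs; split; first exact: interval_open.
  by rewrite /= in_itv.
by move=> [y s] /= [].
Qed.

Lemma time_constant f x :
  (forall t, 0 <= t <= T -> smooth1 f (x, t)) ->
  (forall t, 0 < t < T -> dt f (x, t) = 0) ->
  forall s t, 0 <= s <= T -> 0 <= t <= T -> f (x, s) = f (x, t).
Proof.
move=> sf df0 s t.
wlog st : s t / s <= t.
  move=> H sT tT; have [st|/ltW ts] := leP s t; first exact: H.
  by apply/esym/H.
move=> /andP[s0 sT] /andP[t0 tT].
have df r : 0 <= r <= T -> derivable (fun r => f (x, r)) r 1.
  by move=> rT; apply: smooth1_derivable; exact: smooth1_slicet (sf r rT).
have [||r _] := @MVT_segment R (fun r => f (x, r)) (fun=> 0) s t st.
- move=> r; rewrite in_itv/= => /andP[rs rt]; apply: DeriveDef.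
    by apply: df; apply/andP; split; lra.
  by rewrite derive_slicet df0//; apply/andP; split; lra.
- apply: derivable_within_continuous => r; rewrite in_itv/= => /andP[rs rt].
  by apply: df; apply/andP; split; lra.
by rewrite mul0r => /eqP; rewrite subr_eq0 => /eqP ->.
Qed.

Lemma derive_space_eq0 f x t j : open Omega -> Omega x ->
  (forall y, Omega y -> f (y, t) = 0) -> 'D_(dirx R j) f (x, t) = 0.
Proof.
move=> oO Ox f0; rewrite -derive_slice.
rewrite (near_eq_derive (g := cst 0)) ?derive_cst//.
by apply: filterS (open_nbhs_nbhs (conj oO Ox)) => y /f0.
Qed.

Lemma dt_eq0 f x t : 0 < t < T -> (forall s, 0 < s < T -> f (x, s) = 0) ->
  dt f (x, t) = 0.
Proof.
move=> tT f0; rewrite -derive_slicet.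
rewrite (near_eq_derive (g := cst 0)) ?derive_cst//.
have : \forall s \near t, `]0, T[%classic s.
  by apply: open_nbhs_nbhs; split; [exact: interval_open|rewrite /= in_itv].
by apply: filterS => s; rewrite /= in_itv; exact: f0.
Qed.

End cylinder.

Lemma sum_sym_half (R : realType) (m : nat) (s a : 'I_m -> 'I_m -> R) :
  (forall i j, s i j = s j i) ->
  \sum_i \sum_j s i j * (2^-1 * (a i j + a j i)) = \sum_i \sum_j s i j * a i j.
Proof.
move=> ssym; have E : \sum_i \sum_j s i j * a j i = \sum_i \sum_j s i j * a i j.
  rewrite exchange_big; apply: eq_bigr => i _; apply: eq_bigr => j _.
  by rewrite ssym.
transitivity (2^-1 * (\sum_i \sum_j s i j * a i j + \sum_i \sum_j s i j * a j i)).
  rewrite -big_split mulr_sumr; apply: eq_bigr => i _ /=.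
  rewrite -big_split mulr_sumr; apply: eq_bigr => j _ /=; ring.
by rewrite E; lra.
Qed.

(** The system satisfied by the difference [D] of two solutions. The fields [V],
    [E] and [S] are those by which the two velocities, strains and stresses
    differ, up to sign. *)
Section homogeneous.
Context {R : realType}.
Variables (Omega Gs Gu : set (vec R)) (n : vec R -> vec R) (T : R)
  (c : coefficients R) (D : dual R).
Hypotheses (hOmega : regular_domain Omega n)
  (hG : boundary Omega = closure (Gs `|` Gu)) (T0 : 0 < T)
  (hc : admissible_coefficients Omega T c)
  (hcs : smooth_coefficients Omega T c)
  (rho0 : forall x, closure Omega x -> 0 < rho c x)
  (Cmajor : forall x, closure Omega x -> major_sym (Cm c x))
  (Cpos : forall x, closure Omega x -> posdef_sym (Cm c x))
  (sD : forall p, ccyl Omega T p -> smooth_dual D p)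
  (hD : class_condition Omega Gs Gu n T c D).

Let V p := (rr c p.1)^-1 *: Ldv c D p.
Let E p := app4 (Ainv c p) (LdE c D p).
Let S p := app4 (Cm c p.1) (E p).

Hypotheses
  (eqU : forall x t, Omega x -> 0 < t < T -> dt (Ldu D) (x, t) = V (x, t))
  (eqV : forall x t, Omega x -> 0 < t < T ->
     rho c x *: dt V (x, t) = divT S (x, t))
  (eqE : forall x t, Omega x -> 0 < t < T ->
     grad (Ldu D) (x, t) = E (x, t) + skewpart (mu D (x, t))).

Let oO : open Omega. Proof. by case: hOmega. Qed.

Let OC x t : Omega x -> 0 <= t <= T -> ccyl Omega T (x, t).
Proof. by move=> Ox tT; split => //; exact: subset_closure. Qed.

Let tin t : 0 < t < T -> 0 <= t <= T.
Proof. by move=> /andP[? ?]; rewrite !ltW. Qed.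

Let Cminor p i j k l : ccyl Omega T p ->
  Cm c p.1 i j k l = Cm c p.1 j i k l /\ Cm c p.1 i j k l = Cm c p.1 i j l k.
Proof. by move=> [clp _]; have [h _ _] := hc; exact: h. Qed.

Let Csym p i j k l : ccyl Omega T p -> Cm c p.1 i j k l = Cm c p.1 k l i j.
Proof. by move=> [clp _]; rewrite {1}(Cmajor clp). Qed.

Let GuC x t : Gu x -> 0 <= t <= T -> ccyl Omega T (x, t).
Proof.
move=> Gx tT; split => //=.
have : boundary Omega x by rewrite hG; apply: subset_closure; right.
by case.
Qed.

Let GsC x t : Gs x -> 0 <= t <= T -> ccyl Omega T (x, t).
Proof.
move=> Gx tT; split => //=.
have : boundary Omega x by rewrite hG; apply: subset_closure; left.
by case.
Qed.

Let sU p : ccyl Omega T p -> smooth1 (Ldu D) p.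
Proof. by move=> Cp; exact: smooth1_Ldu (sD Cp). Qed.

Let sV p : ccyl Omega T p -> smooth1 V p.
Proof. by move=> Cp; exact: (smooth1_vLdv hc hcs Cp (sD Cp)). Qed.

Let sE p : ccyl Omega T p -> smooth1 E p.
Proof. by move=> Cp; exact: (smooth1_ELdE hcs Cp (sD Cp)). Qed.

Let sS p : ccyl Omega T p -> smooth1 S p.
Proof.
move=> Cp; apply: (@smooth1_app4 _ _ (fun q : stime R => Cm c q.1)) => [i j k l|].
  exact: smooth1_Cmt hcs _ _ _ _ _ Cp.
exact: sE.
Qed.

Let smu p : ccyl Omega T p -> smooth1 (mu D) p.
Proof. by move=> /sD[]. Qed.

Let dcoord m k (F : stime R -> 'M[R]_(m.+1, k.+1)) p w i j : smooth1 F p ->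
  'D_w (fun q => F q i j) p = ('D_w F p) i j.
Proof. by move=> sF; apply: derive_coord; exact: smooth1_derivable. Qed.

Let symt_LdE p : ccyl Omega T p -> symt (LdE c D p).
Proof.
move=> Cp; apply/matrixP => i j; rewrite !mxE (addrC (mu D p j i)).
congr (_ - _); apply: eq_bigr => k _; apply: eq_bigr => l _; rewrite /tr4.
by have [_ ->] := Cminor k l j i Cp.
Qed.

Let symt_E i j p : ccyl Omega T p -> E p i j = E p j i.
Proof.
move=> Cp; have [_ _ /(_ p Cp)[_ _ inv]] := hc.
have [sy' _ _] := inv _ (symt_LdE Cp).
have sy : (E p)^T = E p := sy'.
by rewrite -{1}sy mxE.
Qed.

Let SE i j : (fun p => S p i j) =
  (fun p => \sum_k \sum_l Cm c p.1 i j k l * E p k l).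
Proof. by apply/funext => p; rewrite mxE. Qed.

Let symt_S i j p : ccyl Omega T p -> S p i j = S p j i.
Proof.
move=> Cp; rewrite !mxE; apply: eq_bigr => k _; apply: eq_bigr => l _.
by have [-> _] := Cminor i j k l Cp.
Qed.

Let W i j p : R := skewpart (mu D p) i j.

Let WE i j : W i j = (fun p => 2^-1 * (mu D p i j - mu D p j i)).
Proof. by apply/funext => p; rewrite /W !mxE. Qed.

Let sW i j p : ccyl Omega T p -> smooth1 (W i j) p.
Proof.
move=> Cp; rewrite WE; apply: smooth1M; first exact: smooth1_cst.
exact: (smooth1B (smooth1_coord i j (smu Cp)) (smooth1_coord j i (smu Cp))).
Qed.

Let Wskew i j : W i j = (fun p => - W j i p).
Proof. by apply/funext => p; rewrite !WE; ring. Qed.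

Let dUx i j x t : Omega x -> 0 < t < T ->
  'D_(dirx R j) (fun q => Ldu D q 0 i) (x, t) = E (x, t) i j + W i j (x, t).
Proof.
move=> Ox tT; have Cp := OC Ox (tin tT).
rewrite (dcoord _ _ _ (sU Cp)).
transitivity (grad (Ldu D) (x, t) i j); first by rewrite [RHS]mxE.
by rewrite (eqE Ox tT) [LHS]mxE.
Qed.

Let dUt i x t : Omega x -> 0 < t < T ->
  dt (fun q => Ldu D q 0 i) (x, t) = V (x, t) 0 i.
Proof.
move=> Ox tT; have Cp := OC Ox (tin tT).
by rewrite /dt (dcoord _ _ _ (sU Cp)) -(eqU Ox tT).
Qed.

(** The condition on [Gu] concerns [Ldu D], whereas the boundary power involves
    [V]; the equation relating them is therefore needed on the boundary too. *)
Let V_dtU i p : ccyl Omega T p -> V p 0 i = dt (fun q => Ldu D q 0 i) p.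
Proof.
apply: (cyl_continuous_eq (f := fun p => V p 0 i) T0) p => [p Cp|p Cp|x t Ox tT].
- exact: smooth1_continuous (smooth1_coord 0 i (sV Cp)).
- exact: smooth1_continuousD (smooth1_coord 0 i (sU Cp)).
- by rewrite dUt.
Qed.

(** As [grad (Ldu D) = E + W], exchanging the derivatives gives
    [dt E = grad V - dt W], and the antisymmetric [dt W] does no work against the
    symmetric stress. The function [Ldu D] is only C^1, but its derivatives [V]
    and [E + W] are C^1 again. *)
Let primal_compatibility x t : Omega x -> 0 < t < T ->
  \sum_i \sum_j S (x, t) i j * dt (fun p => E p i j) (x, t) =
  \sum_i \sum_j S (x, t) i j * 'D_(dirx R j) (fun p => V p 0 i) (x, t).
Proof.
move=> Ox tT; have Cp := OC Ox (tin tT).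
have dtE i j : dt (fun p => E p i j) (x, t) =
    'D_(dirx R j) (fun p => V p 0 i) (x, t) - dt (W i j) (x, t).
  apply/eqP; rewrite -subr_eq opprK; apply/eqP.
  have sEij := smooth1_coord i j (sE Cp).
  rewrite /dt -(derive_smoothD _ sEij (sW i j Cp)).
  have nx : \forall q \near (x, t),
      'D_(dirx R j) (fun q => Ldu D q 0 i) q = E q i j + W i j q.
    by apply: filterS (near_cyl oO Ox tT) => -[y s] /= [Oy sT]; exact: dUx.
  have nt : \forall q \near (x, t), 'D_(dirt R) (fun q => Ldu D q 0 i) q = V q 0 i.
    by apply: filterS (near_cyl oO Ox tT) => -[y s] /= [Oy sT]; exact: dUt.
  exact: (smooth1_derive_comm (smooth1_coord 0 i (sU Cp)) nx nt
    (smooth1D sEij (sW i j Cp)) (smooth1_coord 0 i (sV Cp))).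
have skew0 : \sum_i \sum_j S (x, t) i j * dt (W i j) (x, t) = 0.
  set X := LHS; suff : X = - X by move=> ?; lra.
  rewrite {1}/X exchange_big /X -sumrN; apply: eq_bigr => i _.
  rewrite -sumrN; apply: eq_bigr => j _; rewrite symt_S//.
  rewrite (Wskew j i) -mulrN; congr (_ * _).
  by apply: deriveN; exact: smooth1_derivable (sW i j Cp).
transitivity (\sum_i (\sum_j S (x, t) i j * 'D_(dirx R j) (fun p => V p 0 i) (x, t)
    - \sum_j S (x, t) i j * dt (W i j) (x, t))); last by rewrite sumrB skew0 subr0.
apply: eq_bigr => i _; rewrite -sumrB.
by apply: eq_bigr => j _; rewrite dtE mulrBr.
Qed.

(** At time [0] the gradient of [Ldu D] vanishes, so the symmetric [E] and the
    antisymmetric [W] are opposite, hence both zero. *)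
Let primal_initial x : Omega x ->
  (forall i, V (x, 0) 0 i = 0) /\ (forall i j, E (x, 0) i j = 0).
Proof.
have zT : 0 <= (0 : R) <= T by rewrite lexx ltW.
move=> Ox; have Cp := OC Ox zT; have [_ _ U0 V0 _] := hD; split=> [i|i j].
  by rewrite /V V0// mxE.
have dU k l : E (x, 0) k l + W k l (x, 0) = 0.
  have -> : E (x, 0) k l + W k l (x, 0) = 'D_(dirx R l) (fun q => Ldu D q 0 k) (x, 0).
    apply: (cyl_continuous_eq (f := fun p => E p k l + W k l p)
      (g := 'D_(dirx R l) (fun q => Ldu D q 0 k)) T0 _ _ _ Cp).
    + move=> p Cp'.
      exact: smooth1_continuous (smooth1D (smooth1_coord k l (sE Cp')) (sW k l Cp')).
    + by move=> p Cp'; exact: smooth1_continuousD (smooth1_coord 0 k (sU Cp')).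
    + by move=> y s Oy sT; rewrite dUx.
  by apply: (derive_space_eq0 (f := fun q => Ldu D q 0 k) l oO Ox) => y Oy; rewrite U0// mxE.
have := dU i j; have := dU j i.
rewrite (symt_E j i Cp) Wskew => h1 h2; lra.
Qed.

Let primal_zero x t : Omega x -> 0 <= t <= T -> V (x, t) = 0 /\ E (x, t) = 0.
Proof.
have zT : 0 <= (0 : R) <= T by rewrite lexx ltW.
move=> Ox tT; have [_ rho_s _ _ _] := hcs.
have sdens y : closure Omega y -> smooth1 (rho c) y.
  by move=> cly; exact: C2_near_smooth1 rho_s cly.
have sC y i j k l := @smooth1_Cm R Omega T c hcs i j k l y.
have [] := energy_uniqueness hOmega hG T0 sdens sC rho0 Cmajor Cpos
  (v := fun i p => V p 0 i) (e := fun i j p => E p i j)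
  (fun i p Cp => smooth1_coord 0 i (sV Cp))
  (fun i j p Cp => smooth1_coord i j (sE Cp)) symt_E _ _ _ _ zT
  (fun y i Oy => (primal_initial Oy).1 i) (fun y i j Oy => (primal_initial Oy).2 i j) Ox tT.
- move=> y r i Oy rT; have Cp := OC Oy (tin rT).
  have -> : \sum_j 'D_(dirx R j) (fun p => \sum_k \sum_l Cm c p.1 i j k l * E p k l)
      (y, r) = divT S (y, r) 0 i.
    rewrite [RHS]mxE; apply: eq_bigr => j _.
    by rewrite -(dcoord _ i j (sS Cp)) SE.
  by rewrite -(eqV Oy rT) [RHS]mxE /dt (dcoord _ 0 i (sV Cp)).
- move=> y r Oy rT; apply: etrans (etrans (primal_compatibility Oy rT) _).
    by apply: eq_bigr => i _; apply: eq_bigr => j _; rewrite [S _ i j]mxE.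
  by apply: eq_bigr => i _; apply: eq_bigr => j _; rewrite [S _ i j]mxE.
- move=> y r i Gy rT; have Cp := GuC Gy (tin rT).
  rewrite (V_dtU _ Cp); have [U0 _ _ _ _] := hD.
  apply: (dt_eq0 (f := fun q => Ldu D q 0 i) rT) => s sT.
  by rewrite U0// mxE.
- move=> y r i Gy ry rT; have [_ S0 _ _ _] := hD.
  have /rowP/(_ i) := S0 y r (conj Gy ry) rT.
  rewrite [X in X = _]mxE [X in _ = X]mxE => s0.
  rewrite -[RHS]s0; apply: eq_bigr => j _; congr (_ * _).
  by rewrite [RHS]mxE.
move=> V0 E0; split; first by apply/rowP => i; rewrite V0 mxE.
by apply/matrixP => i j; rewrite E0 mxE.
Qed.

Let Ldu0 x t : Omega x -> 0 <= t <= T -> Ldu D (x, t) = 0.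
Proof.
have zT : 0 <= (0 : R) <= T by rewrite lexx ltW.
move=> Ox tT; apply/rowP => i; have [_ _ U0 _ _] := hD.
rewrite (time_constant (f := fun q => Ldu D q 0 i) _ _ tT zT).
- by rewrite U0// mxE.
- by move=> r rT; exact: (smooth1_coord 0 i (sU (OC Ox rT))).
- by move=> r rT; rewrite dUt// (primal_zero Ox (tin rT)).1 mxE.
Qed.

Let skew0 i j x t : Omega x -> 0 < t < T -> W i j (x, t) = 0.
Proof.
move=> Ox tT; have := dUx i j Ox tT.
rewrite (derive_space_eq0 (f := fun q => Ldu D q 0 i) j oO Ox) => [|y Oy].
  by rewrite (primal_zero Ox (tin tT)).2 mxE add0r.
by rewrite Ldu0 ?tin// mxE.
Qed.

Let LdE0 x t : Omega x -> 0 <= t <= T -> LdE c D (x, t) = 0.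
Proof.
move=> Ox tT; have Cp := OC Ox tT.
have [_ _ /(_ (x, t) Cp)[_ _ inv]] := hc.
have [_ <- _] := inv _ (symt_LdE Cp).
have E0 : app4 (Ainv c (x, t)) (LdE c D (x, t)) = 0 := (primal_zero Ox tT).2.
rewrite E0; apply/matrixP => i j; rewrite !mxE.
by rewrite big1// => k _; rewrite big1// => l _; rewrite mxE mulr0.
Qed.

(** From here on [lam D] plays the part of a displacement, with velocity [lam_t],
    gradient [lam_x], strain [lam_e] and stress [lam_s]. *)
Let lam_t i p : R := ('D_(dirt R) (lam D) p) 0 i.
Let lam_x i j p : R := ('D_(dirx R j) (lam D) p) 0 i.
Let lam_e i j p : R := 2^-1 * (lam_x i j p + lam_x j i p).
Let lam_s i j (p : stime R) : R := \sum_k \sum_l Cm c p.1 i j k l * lam_e k l p.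

Let slam p : ccyl Omega T p -> smooth1 (lam D) p.
Proof. by move=> /sD[]. Qed.

Let slam_t i p : ccyl Omega T p -> smooth1 (lam_t i) p.
Proof.
by move=> /sD[_ _ _ h]; have [_ h' _] := h (dirt R); exact: (smooth1_coord 0 i h').
Qed.

Let slam_x i j p : ccyl Omega T p -> smooth1 (lam_x i j) p.
Proof.
by move=> /sD[_ _ _ h]; have [_ h' _] := h (dirx R j); exact: (smooth1_coord 0 i h').
Qed.

Let slam_e i j p : ccyl Omega T p -> smooth1 (lam_e i j) p.
Proof.
move=> Cp; apply: smooth1M; first exact: smooth1_cst.
exact: smooth1D (slam_x i j Cp) (slam_x j i Cp).
Qed.

Let slam_s i j p : ccyl Omega T p -> smooth1 (lam_s i j) p.
Proof.
move=> Cp; apply: smooth1_sum => k; apply: smooth1_sum => l.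
exact: smooth1M (smooth1_Cmt hcs i j k l Cp) (slam_e k l Cp).
Qed.

(** [mu D] is symmetric as [W = 0], and [LdE c D = 0] then says that it is the
    stress of [lam D]. *)
Let lam_s_mu i j p : ccyl Omega T p -> lam_s i j p = mu D p i j.
Proof.
move: p; apply: (cyl_continuous_eq T0) => [p Cp|p Cp|x t Ox tT].
- exact: smooth1_continuous (slam_s i j Cp).
- exact: smooth1_continuous (smooth1_coord i j (smu Cp)).
have Cp := OC Ox (tin tT).
have mu_sym : mu D (x, t) i j = sympart (mu D (x, t)) i j.
  have := skew0 i j Ox tT; rewrite WE !mxE => W0; lra.
have := LdE0 Ox (tin tT) => /eqP; rewrite subr_eq0 => /eqP L0.
rewrite mu_sym L0 mxE /lam_s sum_sym_half => [|k l]; last by have [_ ->] := Cminor i j k l Cp.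
apply: eq_bigr => k _; apply: eq_bigr => l _.
by rewrite [grad _ _ _ _]mxE /tr4 (Csym i j k l Cp).
Qed.

Let symt_lam_s i j p : ccyl Omega T p -> lam_s i j p = lam_s j i p.
Proof.
move=> Cp; apply: eq_bigr => k _; apply: eq_bigr => l _.
by have [-> _] := Cminor i j k l Cp.
Qed.

Let gam_lam_t i x t : Omega x -> 0 <= t <= T ->
  gam D (x, t) 0 i = - (rho c x * lam_t i (x, t)).
Proof.
move=> Ox tT; have := (primal_zero Ox tT).1 => /eqP; rewrite /V scaler_eq0.
have [_ r0 _] := hc; have clx : closure Omega x by exact: subset_closure.
rewrite invr_eq0 gt_eqF ?r0//= => /eqP/rowP/(_ i).
rewrite /Ldv !mxE -/(lam_t i (x, t)) => h; lra.
Qed.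

(** This is [Ldu D = 0], since [gam D = - rho lam_t] and [mu D = lam_s]. *)
Let dual_momentum x t i : Omega x -> 0 < t < T ->
  rho c x * dt (lam_t i) (x, t) = \sum_j 'D_(dirx R j) (lam_s i j) (x, t).
Proof.
move=> Ox tT; have Cp := OC Ox (tin tT).
have [sg _ _ _] := sD Cp.
have dg : ('D_(dirt R) (gam D) (x, t)) 0 i = - (rho c x * dt (lam_t i) (x, t)).
  rewrite -(dcoord _ 0 i sg).
  have sr := smooth1_rho hcs Cp.
  transitivity ('D_(dirt R) (fun q => - (rho c q.1 * lam_t i q)) (x, t)).
    apply: near_eq_derive; apply: filterS (near_cyl oO Ox tT) => -[y s] /= [Oy sT].
    by apply: gam_lam_t => //; exact: tin.
  have d0 : 'D_(dirt R) (fun q : stime R => rho c q.1) (x, t) = 0 :=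
    derive_space_dirt (rho c) (x, t).
  have -> : 'D_(dirt R) (fun q => - (rho c q.1 * lam_t i q)) (x, t) =
      - 'D_(dirt R) (fun q => rho c q.1 * lam_t i q) (x, t).
    by apply: deriveN; exact: smooth1_derivable (smooth1M sr (slam_t i Cp)).
  by rewrite (derive_smoothM _ sr (slam_t i Cp)) d0 mulr0 addr0.
have dm j : 'D_(dirx R j) (lam_s i j) (x, t) = ('D_(dirx R j) (mu D) (x, t)) i j.
  rewrite -(dcoord _ i j (smu Cp)).
  apply: near_eq_derive; apply: filterS (near_cyl oO Ox tT) => -[y s] /= [Oy sT].
  by apply: lam_s_mu; apply: OC => //; exact: tin.
rewrite (eq_bigr _ (fun j _ => dm j)).
have /rowP/(_ i) := Ldu0 Ox (tin tT).
rewrite [X in X = _]mxE [X in _ = X]mxE [X in _ + X = _]mxE.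
rewrite -[X in X + _]/(('D_(dirt R) (gam D) (x, t)) 0 i) dg => h; lra.
Qed.

Let dual_compatibility x t : Omega x -> 0 < t < T ->
  \sum_i \sum_j lam_s i j (x, t) * dt (lam_e i j) (x, t) =
  \sum_i \sum_j lam_s i j (x, t) * 'D_(dirx R j) (lam_t i) (x, t).
Proof.
move=> Ox tT; have Cp := OC Ox (tin tT).
apply: etrans _ (sum_sym_half (fun i j => 'D_(dirx R j) (lam_t i) (x, t))
  (fun i j => symt_lam_s i j Cp)).
apply: eq_bigr => i _; apply: eq_bigr => j _; congr (_ * _).
have dg k l : 'D_(dirt R) (lam_x k l) (x, t) = 'D_(dirx R l) (lam_t k) (x, t).
  have sl := smooth1_near (slam Cp).
  have nx : \forall q \near (x, t), 'D_(dirx R l) (fun q => lam D q 0 k) q = lam_x k l q.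
    by apply: filterS sl => q sq; exact: dcoord.
  have nt : \forall q \near (x, t), 'D_(dirt R) (fun q => lam D q 0 k) q = lam_t k q.
    by apply: filterS sl => q sq; exact: dcoord.
  exact: (smooth1_derive_comm (smooth1_coord 0 k (slam Cp)) nx nt (slam_x k l Cp) (slam_t k Cp)).
have sgg := smooth1D (slam_x i j Cp) (slam_x j i Cp).
rewrite /dt (derive_smoothM _ (smooth1_cst (2^-1 : R) (x, t)) sgg) derive_cst mulr0 addr0.
rewrite (derive_smoothD _ (slam_x i j Cp) (slam_x j i Cp)).
exact: (congr1 (fun z => 2^-1 * z) (congr2 +%R (dg i j) (dg j i))).
Qed.

(** Final values replace the initial values: the second elastodynamic problem is
    solved backward in time. *)
Let dual_final x : Omega x ->
  (forall i, lam_t i (x, T) = 0) /\ (forall i j, lam_e i j (x, T) = 0).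
Proof.
have TT : 0 <= T <= T by rewrite lexx ltW.
move=> Ox; have Cp := OC Ox TT; have [_ _ _ _ [gl _ _ _ [_ L0]]] := hD.
have clx : closure Omega x by exact: subset_closure.
split=> [i|i j].
  have := gam_lam_t i Ox TT; rewrite (gl x Ox).1 mxE => /eqP.
  by rewrite eq_sym oppr_eq0 mulf_eq0 gt_eqF ?rho0//= => /eqP.
have g0 k l : lam_x k l (x, T) = 0.
  rewrite -[LHS](dcoord _ 0 k (slam Cp)).
  apply: (derive_space_eq0 (f := fun q => lam D q 0 k) l oO Ox) => y Oy.
  by rewrite (gl y Oy).2 mxE.
by rewrite /lam_e !g0 addr0 mulr0.
Qed.

Let dual_zero x t : Omega x -> 0 <= t <= T ->
  (forall i, lam_t i (x, t) = 0) /\ (forall i j, lam_e i j (x, t) = 0).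
Proof.
have TT : 0 <= T <= T by rewrite lexx ltW.
move=> Ox tT; have [_ rho_s _ _ _] := hcs.
have sdens y : closure Omega y -> smooth1 (rho c) y.
  by move=> cly; exact: C2_near_smooth1 rho_s cly.
have sC y i j k l := @smooth1_Cm R Omega T c hcs i j k l y.
have [_ _ _ _ [_ lGu mGs _ _]] := hD.
apply: (energy_uniqueness hOmega hG T0 sdens sC rho0 Cmajor Cpos
  slam_t slam_e _ dual_momentum dual_compatibility _ _ TT
  (fun y i Oy => (dual_final Oy).1 i) (fun y i j Oy => (dual_final Oy).2 i j) Ox tT).
- by move=> i j p _; rewrite /lam_e addrC.
- move=> y r i Gy rT; have Cp := GuC Gy (tin rT).
  rewrite -[LHS](dcoord _ 0 i (slam Cp)).
  by apply: (dt_eq0 (f := fun q => lam D q 0 i) rT) => s sT; rewrite lGu// mxE.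
- move=> y r i Gy ry rT; have Cp := GsC Gy (tin rT).
  have /rowP/(_ i) := mGs y r (conj Gy ry) rT.
  rewrite [X in X = _]mxE [X in _ = X]mxE => s0.
  rewrite -[RHS]s0; apply: eq_bigr => j _; congr (_ * _).
  exact: lam_s_mu.
Qed.

Lemma homogeneous_zero p : ccyl Omega T p ->
  [/\ gam D p = 0, lam D p = 0 & mu D p = 0].
Proof.
have TT : 0 <= T <= T by rewrite lexx ltW.
move=> Cp; split.
- apply/rowP => i; rewrite mxE; move: p Cp.
  apply: (cyl_continuous_eq0 (f := fun p => gam D p 0 i) T0) => [p Cp|x t Ox tT].
    by have [sg _ _ _] := sD Cp; exact: smooth1_continuous (smooth1_coord 0 i sg).
  by rewrite gam_lam_t ?tin// (dual_zero Ox (tin tT)).1 mulr0 oppr0.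
- apply/rowP => i; rewrite mxE; move: p Cp.
  apply: (cyl_continuous_eq0 (f := fun p => lam D p 0 i) T0) => [p Cp|x t Ox tT].
    exact: smooth1_continuous (smooth1_coord 0 i (slam Cp)).
  have [_ _ _ _ [gl _ _ _ _]] := hD.
  rewrite (time_constant (f := fun q => lam D q 0 i) _ _ (tin tT) TT).
  + by rewrite (gl x Ox).2 mxE.
  + by move=> r rT; exact: (smooth1_coord 0 i (slam (OC Ox rT))).
  + move=> r rT; rewrite /dt (dcoord _ 0 i (slam (OC Ox (tin rT)))).
    exact: (dual_zero Ox (tin rT)).1.
- apply/matrixP => i j; rewrite mxE -lam_s_mu//; move: p Cp.
  apply: (cyl_continuous_eq0 (f := lam_s i j) T0) => [p Cp|x t Ox tT].
    exact: smooth1_continuous (slam_s i j Cp).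
  rewrite /lam_s big1// => k _; rewrite big1// => l _.
  by rewrite (dual_zero Ox (tin tT)).2 mulr0.
Qed.

End homogeneous.

(** * Differences of solutions *)

Section linearity.
Context {R : realType}.

Lemma app4B (A : tensor4 R) (a b : tensor2 R) :
  app4 A (a - b) = app4 A a - app4 A b.
Proof.
apply/matrixP => i j; rewrite !mxE -sumrB; apply: eq_bigr => k _.
by rewrite -sumrB; apply: eq_bigr => l _; rewrite !mxE mulrBr.
Qed.

Lemma sympartB (a b : tensor2 R) : sympart (a - b) = sympart a - sympart b.
Proof. by apply/matrixP => i j; rewrite !mxE; ring. Qed.

Lemma skewpartB (a b : tensor2 R) : skewpart (a - b) = skewpart a - skewpart b.
Proof. by apply/matrixP => i j; rewrite !mxE; ring. Qed.

Lemma derive_of_difference (W X : normedModType R) (F G H : W -> X) p w :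
  smooth1 F p -> smooth1 G p -> (\forall q \near p, H q = G q - F q) ->
  'D_w H p = 'D_w G p - 'D_w F p.
Proof. by move=> sF sG /near_eq_derive ->; exact: derive_smoothB. Qed.

Lemma grad_difference (F G H : stime R -> vec R) p :
  smooth1 F p -> smooth1 G p -> (\forall q \near p, H q = G q - F q) ->
  grad H p = grad G p - grad F p.
Proof.
move=> sF sG HFG; apply/matrixP => i j.
by rewrite [LHS]mxE (derive_of_difference _ sF sG HFG) !mxE.
Qed.

Lemma divT_difference (F G H : stime R -> tensor2 R) p :
  smooth1 F p -> smooth1 G p -> (\forall q \near p, H q = G q - F q) ->
  divT H p = divT G p - divT F p.
Proof.
move=> sF sG HFG; apply/rowP => i.
rewrite /divT !mxE -sumrB; apply: eq_bigr => j _.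
by rewrite (derive_of_difference _ sF sG HFG) !mxE.
Qed.

Lemma Ldu_sub (f g : dual R) p :
  smooth1 (gam f) p -> smooth1 (gam g) p -> smooth1 (mu f) p -> smooth1 (mu g) p ->
  Ldu (dual_sub f g) p = Ldu f p - Ldu g p.
Proof.
move=> fg gg fm gm; rewrite /Ldu /dt /= (derive_smoothB _ fg gg).
have nm : \forall q \near p, (fun q => mu f q - mu g q) q = mu f q - mu g q.
  exact: (@filterE _ (nbhs p) _).
rewrite (divT_difference gm fm nm).
by rewrite opprD addrACA.
Qed.

Lemma Ldv_sub (c : coefficients R) (f g : dual R) p :
  smooth1 (lam f) p -> smooth1 (lam g) p ->
  Ldv c (dual_sub f g) p = Ldv c f p - Ldv c g p.
Proof.
move=> fl gl; rewrite /Ldv /dt /= (derive_smoothB _ fl gl).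
by rewrite scalerBr opprD addrACA.
Qed.

Lemma LdE_sub (c : coefficients R) (f g : dual R) p :
  smooth1 (lam f) p -> smooth1 (lam g) p ->
  LdE c (dual_sub f g) p = LdE c f p - LdE c g p.
Proof.
move=> fl gl; rewrite /LdE /=.
have nl : \forall q \near p, (fun q => lam f q - lam g q) q = lam f q - lam g q.
  exact: (@filterE _ (nbhs p) _).
rewrite (grad_difference gl fl nl).
by rewrite app4B sympartB !opprD !opprK addrACA.
Qed.

Lemma balance_sub (X : zmodType) (a b r s h : X) :
  a - r = h -> b - s = h -> b - a = s - r.
Proof.
move=> <- /(canRL (subrK _)) ->.
by rewrite addrAC [X in X + s]addrAC subrr add0r addrC.
Qed.

Lemma compatibility_sub (a b e1 e2 w w1 w2 : tensor2 R) :
  a - e1 - (w - w1) = 0 -> b - e2 - (w - w2) = 0 ->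
  b - a = e2 - e1 + (w1 - w2).
Proof.
move=> /matrixP h1 /matrixP h2; apply/matrixP => i j.
by have := h1 i j; have := h2 i j; rewrite !mxE => *; lra.
Qed.

End linearity.

Theorem proposition3p1 (R : realType) (Omega Gs Gu : set (vec R))
  (n : vec R -> vec R) (T : R) (c : coefficients R) (d : data R)
  (K : set (dual R))
  (hOmega : regular_domain Omega n)
  (hG : boundary Omega = closure (Gs `|` Gu))
  (hGsu : Gs `&` Gu = set0)
  (hT : 0 < T)
  (hc : admissible_coefficients Omega T c)
  (hcsmooth : smooth_coefficients Omega T c)
  (hdsmooth : smooth_data Omega T d)
  (hEbar : forall p, ccyl Omega T p -> symt (Ebar d p))
  (hWbar : forall p, ccyl Omega T p -> antisymt (Wbar d p))
  (hKsmooth : forall f, K f -> dual_smooth Omega T f)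
  (hK : forall f g, K f -> K g ->
     class_condition Omega Gs Gu n T c (dual_sub f g))
  (hKcont : forall f g, K f -> K g ->
     {within ccyl Omega T, continuous (mu (dual_sub f g))})
  (hrho : forall x, closure Omega x -> 0 < rho c x)
  (hCmajor : forall x, closure Omega x -> major_sym (Cm c x))
  (hCpos : forall x, closure Omega x -> posdef_sym (Cm c x)) :
  forall f g : dual R, K f -> K g ->
    dual_solution Omega Gs Gu n T c d f ->
    dual_solution Omega Gs Gu n T c d g ->
    forall p, ccyl Omega T p ->
      [/\ gam f p = gam g p, lam f p = lam g p & mu f p = mu g p].
Proof.
move=> f g Kf Kg [solf _ _ _ _] [solg _ _ _ _] p Cp.
have sf q : ccyl Omega T q -> smooth_dual f q := dual_smooth_at (hKsmooth f Kf).
have sg q : ccyl Omega T q -> smooth_dual g q := dual_smooth_at (hKsmooth g Kg).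
have sD q (Cq : ccyl Omega T q) := smooth_dual_sub (sf q Cq) (sg q Cq).
have [dub dvb dEb _] := hdsmooth.
have OC x t : Omega x -> 0 < t < T -> ccyl Omega T (x, t).
  move=> Ox /andP[t0 tT]; split; first exact: subset_closure.
  by rewrite /= !ltW.
have su h q : ccyl Omega T q -> smooth_dual h q -> smooth1 (ufield d h) q.
  by move=> Cq sh; exact: (smooth1B (C2_near_smooth1 dub Cq) (smooth1_Ldu sh)).
have sv h q : ccyl Omega T q -> smooth_dual h q -> smooth1 (vfield c d h) q.
  move=> Cq sh.
  exact: (smooth1B (C2_near_smooth1 dvb Cq) (smooth1_vLdv hc hcsmooth Cq sh)).
have ss h q : ccyl Omega T q -> smooth_dual h q -> smooth1 (stress c d h) q.
  move=> Cq sh; apply: (@smooth1_app4 _ _ (fun q : stime R => Cm c q.1)) => [i j k l|].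
    exact: (smooth1_Cmt hcsmooth i j k l Cq).
  exact: (smooth1B (C2_near_smooth1 dEb Cq) (smooth1_ELdE hcsmooth Cq sh)).
have nlam q : ccyl Omega T q ->
    \forall q' \near q, smooth1 (lam f) q' /\ smooth1 (lam g) q'.
  move=> Cq; have [_ lf _ _] := sf q Cq; have [_ lg _ _] := sg q Cq.
  by apply: filterS2 (smooth1_near lf) (smooth1_near lg) => q' h1 h2.
have cancelB (X : zmodType) (a b e : X) : b - e = (a - e) - (a - b).
  by rewrite opprB [RHS]addrC addrA subrK.
have nu q : ccyl Omega T q -> \forall q' \near q,
    Ldu (dual_sub f g) q' = ufield d g q' - ufield d f q'.
  move=> Cq; have [gf _ mf _] := sf q Cq; have [gg _ mg _] := sg q Cq.
  have nm : \forall q' \near q, smooth1 (mu f) q' /\ smooth1 (mu g) q'.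
    by apply: filterS2 (smooth1_near mf) (smooth1_near mg) => q' h1 h2.
  apply: filterS3 (smooth1_near gf) (smooth1_near gg) nm => q' h1 h2 [h3 h4].
  by rewrite (Ldu_sub h1 h2 h3 h4); exact: cancelB.
have Vdiff q : smooth1 (lam f) q -> smooth1 (lam g) q ->
    (rr c q.1)^-1 *: Ldv c (dual_sub f g) q = vfield c d g q - vfield c d f q.
  by move=> lf lg; rewrite (Ldv_sub _ lf lg) scalerBr; exact: cancelB.
have Ediff q : smooth1 (lam f) q -> smooth1 (lam g) q ->
    app4 (Ainv c q) (LdE c (dual_sub f g) q) = Efield c d g q - Efield c d f q.
  by move=> lf lg; rewrite (LdE_sub _ lf lg) app4B; exact: cancelB.
suff [/subr0_eq ? /subr0_eq ? /subr0_eq ?] : [/\ gam (dual_sub f g) p = 0,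
    lam (dual_sub f g) p = 0 & mu (dual_sub f g) p = 0] by [].
apply: (homogeneous_zero hOmega hG hT hc hcsmooth hrho hCmajor hCpos sD
  (hK f g Kf Kg) _ _ _ Cp) => x t Ox tT; have Cxt := OC x t Ox tT;
  have [ef1 ef2 ef3] := solf x t Ox tT; have [eg1 eg2 eg3] := solg x t Ox tT;
  have [suf sug] := (su f _ Cxt (sf _ Cxt), su g _ Cxt (sg _ Cxt));
  have [lf lg] := nbhs_singleton (nlam _ Cxt).
- rewrite /dt (derive_of_difference _ suf sug (nu _ Cxt)) (Vdiff _ lf lg).
  by move/subr0_eq : ef1 => <-; move/subr0_eq : eg1 => <-.
- have nv : \forall q \near (x, t), (rr c q.1)^-1 *: Ldv c (dual_sub f g) q
      = vfield c d g q - vfield c d f q.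
    by apply: filterS (nlam _ Cxt) => q [lf' lg']; exact: Vdiff.
  have ns : \forall q \near (x, t), app4 (Cm c q.1) (app4 (Ainv c q)
      (LdE c (dual_sub f g) q)) = stress c d g q - stress c d f q.
    by apply: filterS (nlam _ Cxt) => q [lf' lg']; rewrite (Ediff _ lf' lg') app4B.
  rewrite (divT_difference (ss f _ Cxt (sf _ Cxt)) (ss g _ Cxt (sg _ Cxt)) ns).
  rewrite /dt (derive_of_difference _ (sv f _ Cxt (sf _ Cxt)) (sv g _ Cxt (sg _ Cxt)) nv).
  move/subr0_eq : ef2 => efb; move/subr0_eq : eg2 => egb.
  by rewrite scalerBr; exact: balance_sub efb egb.
- rewrite (grad_difference suf sug (nu _ Cxt)) (Ediff _ lf lg) skewpartB.
  exact: compatibility_sub ef3 eg3.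
Qed.
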